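(* Assume that $\|\nabla_{\mathbf{x}} f(\mathbf{x})\|\le L$ for all $\mathbf{x}\in\mathcal{X}$. Let $N\ge 1$, let $\mathbf{x}_1,\dots,\mathbf{x}_N$ be independent samples from the density $\rho$, and let $\hat{\lambda}_1\ge\cdots\ge\hat{\lambda}_m\ge 0$ be the eigenvalues of $\hat{C}=\frac1N\sum_{j=1}^N \nabla_{\mathbf{x}} f(\mathbf{x}_j)\,\nabla_{\mathbf{x}} f(\mathbf{x}_j)^T$. Assume $\lambda_1>0$. Then for every $k\in\{1,\dots,m\}$ and every $0<\varepsilon\le 1$, $$\mathbb{P}\left\{\hat{\lambda}_k\ge(1+\varepsilon)\lambda_k\right\}\;\le\;(m-k+1)\exp\left(\frac{-N\lambda_k\varepsilon^2}{4L^2}\right)$$ and $$\mathbb{P}\left\{\hat{\lambda}_k\le(1-\varepsilon)\lambda_k\right\}\;\le\;k\exp\left(\frac{-N\lambda_k^2\varepsilon^2}{4\lambda_1L^2}\right).$$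
   Context: Setting: $m>1$ is an integer and $\mathcal{X}\subseteq\mathbb{R}^m$ is centered at the origin and scaled so that all components of $\mathbf{x}\in\mathcal{X}$ have the same range. $\rho:\mathbb{R}^m\to\mathbb{R}_+$ is a bounded probability density (it integrates to 1), separable (a product of univariate functions of the coordinates), strictly positive on $\mathcal{X}$ and zero outside $\mathcal{X}$. The function $f:\mathcal{X}\to\mathbb{R}$ is differentiable and absolutely continuous, with gradient $\nabla_{\mathbf{x}} f$ written as a column vector. Define the symmetric positive semidefinite $m\times m$ matrix $C=\int (\nabla_{\mathbf{x}} f)(\nabla_{\mathbf{x}} f)^T\,\rho\,d\mathbf{x}$, with eigenvalues $\lambda_1\ge\cdots\ge\lambda_m\ge0$. Norms of vectors are Euclidean norms; $\mathbb{P}$ is the probability with respect to the random samples. *)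

(* Defs.v *)
From HB Require Import structures.
From mathcomp Require Import all_boot all_order all_algebra.
From mathcomp Require Import all_classical all_reals all_analysis.

Set Implicit Arguments.
Unset Strict Implicit.
Unset Printing Implicit Defensive.

Import Order.TTheory GRing.Theory Num.Theory.
Import numFieldNormedType.Exports.

Local Open Scope classical_set_scope.
Local Open Scope ring_scope.

(* R^n is represented by column vectors, with the sigma-algebra generated by
   the coordinates, i.e. the Borel sigma-algebra. *)
Definition measure_colvec_display : measure_display.
Proof. exact. Qed.

Section measurable_colvec.
Context {R : realType} {n : nat}.

Definition coord (i : 'I_n) (x : 'cV[R]_n) : R := x i 0.

Let colvec_set0 : g_sigma_preimage coord set0.
Proof. exact: sigma_algebra0. Qed.

Let colvec_setC A : g_sigma_preimage coord A -> g_sigma_preimage coord (~` A).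
Proof. exact: sigma_algebraC. Qed.

Let colvec_bigcup (F : (set 'cV[R]_n)^nat) :
  (forall i, g_sigma_preimage coord (F i)) ->
  g_sigma_preimage coord (\bigcup_i (F i)).
Proof. exact: sigma_algebra_bigcup. Qed.

HB.instance Definition _ := @isMeasurable.Build measure_colvec_display
  'cV[R]_n (g_sigma_preimage coord) colvec_set0 colvec_setC colvec_bigcup.

Lemma measurable_coord (i : 'I_n) : measurable_fun [set: 'cV[R]_n] (coord i).
Proof.
move=> _ Y mY; rewrite setTI; apply: sub_sigma_algebra => /=.
rewrite -bigcup_seq/=; exists i => /=; first by rewrite mem_index_enum.
by exists Y => //; rewrite setTI.
Qed.

Lemma measurable_fun_coordP d (T : measurableType d) (f : T -> 'cV[R]_n) :
  (forall i, measurable_fun [set: T] (coord i \o f)) ->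
  measurable_fun [set: T] f.
Proof.
move=> mf _ Y mY; rewrite setTI.
suff : (g_sigma_preimage coord : set (set 'cV[R]_n)) `<=`
    [set A | measurable (f @^-1` A)] by apply.
apply: smallest_sub.
  split => /=.
  - by rewrite preimage_set0.
  - by move=> A mA; rewrite setTD preimage_setC; exact: measurableC.
  - by move=> F mF; rewrite preimage_bigcup; exact: bigcup_measurable.
move=> A; rewrite -bigcup_seq => -[i _ [B mB <-]] /=.
by rewrite setTI -comp_preimage -[_ @^-1` _]setTI; exact: mf.
Qed.

End measurable_colvec.

Section lebesgue_colvec.
Context {R : realType}.

Definition cons_cV n (p : R * 'cV[R]_n) : 'cV[R]_n.+1 :=
  \col_(i < n.+1) oapp (fun j => p.2 j 0) p.1 (unlift ord0 i).

Definition uncons_cV n (x : 'cV[R]_n.+1) : R * 'cV[R]_n :=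
  (x ord0 0, \col_j x (lift ord0 j) 0).

Lemma cons_cVK n : cancel (@cons_cV n) (@uncons_cV n).
Proof.
case=> a v; rewrite /uncons_cV mxE unlift_none /=; congr (_, _).
by apply/colP => j; rewrite !mxE liftK.
Qed.

Lemma measurable_cons_cV n : measurable_fun setT (@cons_cV n).
Proof.
apply: measurable_fun_coordP => i; case: (unliftP ord0 i) => [j|] ->.
  rewrite (_ : _ \o _ = coord j \o snd).
    exact: measurableT_comp (measurable_coord j) measurable_snd.
  by apply/funext => -[a v] /=; rewrite /coord mxE liftK.
rewrite (_ : _ \o _ = fst); first exact: measurable_fst.
by apply/funext => -[a v] /=; rewrite /coord mxE unlift_none.
Qed.

Lemma measurable_uncons_cV n : measurable_fun setT (@uncons_cV n).
Proof.
apply/measurable_fun_pairP; split; first exact: (measurable_coord ord0).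
apply: measurable_fun_coordP => j.
rewrite (_ : _ \o _ = coord (lift ord0 j)); first exact: measurable_coord.
by apply/funext => x /=; rewrite /coord mxE.
Qed.

Section step.
Variables (n : nat) (mu : {sigma_finite_measure set 'cV[R]_n -> \bar R}).

Definition lebesgue_cVS : set 'cV[R]_n.+1 -> \bar R :=
  pushforward (@lebesgue_measure R \x mu)%E (@cons_cV n).

HB.instance Definition _ := Measure.copy lebesgue_cVS
  (measure_function_pushforward__canonical__measure_function_Measure
     (@lebesgue_measure R \x mu)%E (@measurable_cons_cV n)).

Lemma lebesgue_cVSX (A : set R) (B : set 'cV[R]_n) :
  measurable A -> measurable B ->
  lebesgue_cVS (@uncons_cV n @^-1` (A `*` B)) = (lebesgue_measure A * mu B)%E.
Proof.
move=> mA mB; rewrite /lebesgue_cVS /pushforward -comp_preimage.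
rewrite (_ : _ \o _ = id) ?preimage_id ?product_measure1E//.
by apply/funext => p /=; rewrite cons_cVK.
Qed.

Let lebesgue_cVS_sigma_finite : sigma_finite setT lebesgue_cVS.
Proof.
have /sigma_finiteP[F [TF ndF Foo]] := sigma_finiteT (@lebesgue_measure R).
have /sigma_finiteP[G [TG ndG Goo]] := sigma_finiteT mu.
exists (fun k => @uncons_cV n @^-1` (F k `*` G k)).
  rewrite -preimage_bigcup; apply/esym; rewrite -subTset => x _.
  have [i _ Fi] : (\bigcup_k F k) (uncons_cV x).1 by rewrite -TF.
  have [j _ Gj] : (\bigcup_k G k) (uncons_cV x).2 by rewrite -TG.
  exists (maxn i j) => //; split.
  - by move: Fi; exact/subsetPset/ndF/leq_maxl.
  - by move: Gj; exact/subsetPset/ndG/leq_maxr.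
move=> k; have [mF Fk] := Foo k; have [mG Gk] := Goo k; split.
  by rewrite -[_ @^-1` _]setTI; apply: measurable_uncons_cV => //;
    exact: measurableX.
by rewrite lebesgue_cVSX// lte_mul_pinfty// ge0_fin_numE.
Qed.

HB.instance Definition _ := Measure_isSigmaFinite.Build _ _ _ lebesgue_cVS
  lebesgue_cVS_sigma_finite.

End step.

(* Lebesgue measure on R^n, as the n-fold product of the one on R. *)
Fixpoint lebesgue_cV n : {sigma_finite_measure set 'cV[R]_n -> \bar R} :=
  match n with
  | 0 => \d_(0 : 'cV[R]_0)
  | n'.+1 => lebesgue_cVS (lebesgue_cV n')
  end.

Lemma lebesgue_cV_box n (A : 'I_n -> set R) : (forall i, measurable (A i)) ->
  lebesgue_cV n [set x | forall i, A i (x i 0)] =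
  (\prod_(i < n) lebesgue_measure (A i))%E.
Proof.
elim: n A => [|n IHn] A mA /=.
  by rewrite big_ord0 diracE mem_set// => -[].
have mB : measurable [set x : 'cV[R]_n | forall j, A (lift ord0 j) (x j 0)].
  rewrite (_ : mkset _ = \bigcap_(j in [set: 'I_n])
      (coord j @^-1` A (lift ord0 j))).
    apply: fin_bigcap_measurable => // j _.
    by rewrite -[_ @^-1` _]setTI; exact: measurable_coord.
  by apply/seteqP; split => x /= Ax i => [_|]; apply: Ax.
rewrite big_ord_recl -IHn// -lebesgue_cVSX//.
congr (lebesgue_cVS _ _); apply/seteqP; split => x /=.
  by move=> Ax; split => [|j] /=; rewrite ?mxE; exact: Ax.
move=> [/= A0 A1] i; case: (unliftP ord0 i) => [j|] -> //.
by have := A1 j; rewrite mxE.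
Qed.

End lebesgue_colvec.

Section vectors.
Context {R : realType} {m : nat}.

Definition dotv (u v : 'cV[R]_m) : R := \sum_i u i 0 * v i 0.

Definition norm2 (v : 'cV[R]_m) : R := Num.sqrt (dotv v v).

(* The components of x have the same range over X, with midpoint 0: they all
   have infimum -a and supremum a for one (possibly infinite) a. *)
Definition centered_same_range (X : set 'cV[R]_m) :=
  exists a : \bar R, forall i : 'I_m,
    ereal_inf [set (x i 0)%:E | x in X] = (- a)%E /\
    ereal_sup [set (x i 0)%:E | x in X] = a.

Definition separable_fun (rho : 'cV[R]_m -> R) :=
  exists r : 'I_m -> R -> R, forall x, rho x = \prod_i r i (x i 0).

Definition is_density (rho : 'cV[R]_m -> R) :=
  [/\ measurable_fun setT rho, forall x, 0 <= rho x &
      (\int[lebesgue_cV m]_x (rho x)%:E = 1)%E].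

(* Differentiability is relative to X, so that only the values of f on X
   matter; X need not be open. *)
Definition is_gradient_on (X : set 'cV[R]_m) (f : 'cV[R]_m -> R)
    (g : 'cV[R]_m -> 'cV[R]_m) :=
  forall x, X x -> forall e, 0 < e -> \forall y \near within X (nbhs x),
    `|f y - f x - dotv (g x) (y - x)| <= e * norm2 (y - x).

Definition abs_continuous (a b : R) (h : R -> R) :=
  forall e, 0 < e -> exists2 d, 0 < d &
    forall n (s t : 'I_n -> R),
      (forall i, a <= s i /\ s i <= t i /\ t i <= b) ->
      trivIset setT (fun i => `]s i, t i[%classic) ->
      \sum_i (t i - s i) < d ->
      \sum_i `|h (t i) - h (s i)| < e.

(* Absolute continuity of a function of several variables, along each segment
   contained in X. *)
Definition abs_continuous_on (X : set 'cV[R]_m) (f : 'cV[R]_m -> R) :=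
  forall x y, (forall t, 0 <= t <= 1 -> X (x + t *: (y - x))) ->
    abs_continuous 0 1 (fun t => f (x + t *: (y - x))).

Definition outer (v : 'cV[R]_m) : 'M[R]_m := v *m v^T.

Definition grad_cov (X : set 'cV[R]_m) (rho : 'cV[R]_m -> R)
    (g : 'cV[R]_m -> 'cV[R]_m) : 'M[R]_m :=
  \matrix_(i, j) \int[lebesgue_cV m]_(x in X) (outer (g x) i j * rho x).

(* Sampled gradients outside X (a null event) are set to 0. *)
Definition sample_grad_cov (X : set 'cV[R]_m) (g : 'cV[R]_m -> 'cV[R]_m)
    N (x : 'I_N -> 'cV[R]_m) : 'M[R]_m :=
  N%:R^-1 *: \sum_j (if x j \in X then outer (g (x j)) else 0).

(* l 1 >= ... >= l m are the eigenvalues of A with multiplicity; l is indexed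
   from 1 and its other values are irrelevant. *)
Definition eigenvalues_desc (A : 'M[R]_m) (l : nat -> R) :=
  char_poly A = \prod_(1 <= i < m.+1) ('X - (l i)%:P) /\
  forall i j, (1 <= i)%N -> (i <= j)%N -> (j <= m)%N -> l j <= l i.

End vectors.

Section sampling.
Context {d d' : measure_display} {W : measurableType d} {T : measurableType d'}
  {R : realType} {P : probability W R}.

Definition independent_RVs N (x : 'I_N -> {RV P >-> T}) :=
  forall (J : {set 'I_N}) (A : 'I_N -> set T), (forall j, measurable (A j)) ->
    (P (\bigcap_(j in [set j | j \in J]) (x j @^-1` A j)) =
     \prod_(j in J) P (x j @^-1` A j))%E.

Definition has_density (mu : set T -> \bar R) (x : {RV P >-> T})
    (rho : T -> R) :=
  forall A, measurable A ->
    (distribution P x A = \int[mu]_(y in A) (rho y)%:E)%E.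

End sampling.

(* Main.v *)
(* The random matrices are compressed to the span of the eigenvectors of C for
   the eigenvalues k, ..., m (upper tail) or 1, ..., k (lower tail); by
   Courant-Fischer the event forces an extreme eigenvalue of the compressed sum
   S = Y_1 + ... + Y_N, Y_j = y_j y_j^T, to be large or small.

   Instead of tr exp (t S), which calls for Golden-Thompson or Lieb, one bounds
   E tr (K I +- S)^p with K = p / t and lets p tend to infinity.  Adding one
   rank-one sample costs
     tr (A + y y^T)^p - tr A^p = sum_i y^T A^(p-1-i) (A + y y^T)^i y,
   and since b_p = y^T A^p y is log-convex for positive definite A, every term is
   at least b_(p-1) and at most (1 + |y|^2 / c)^i b_(p-1) when A >= c I.  The
   bound is linear in y y^T, so it can be integrated against the law of the new
   sample.  With t = eps / (2 L^2) both tails get exponent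
   - N lambda_k eps^2 / (4 L^2), which for the lower tail is stronger than
   required. *)
Require Import Defs.
From HB Require Import structures.
From mathcomp Require Import all_boot all_order all_algebra.
From mathcomp Require Import all_classical all_reals all_analysis.
From mathcomp Require Import measurable_realfun ring lra.

Set Implicit Arguments.
Unset Strict Implicit.
Unset Printing Implicit Defensive.

Import Order.TTheory GRing.Theory Num.Theory.
Import numFieldNormedType.Exports.

Local Open Scope classical_set_scope.
Local Open Scope ring_scope.

(** * Moments of positive definite matrices *)

Section quadratic_forms.
Context {R : realFieldType}.

(** The recursion over samples closes because the compressed mean [D] is diagonal with all entries
    on one side of [lam]. In the upper tail, for instance, tr (A^(p-1) D) <= lam tr A^(p-1) <= (lam
    / K) tr A^p, so a new sample multiplies the expected trace by a factor that does not depend on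
    the past. Since K grows like p, |y|^2 / c is of order 1 / p, and the factors (1 + |y|^2 / c)^i
    stay bounded in the limit. In the lower tail samples are subtracted: the shift must keep all
    partial differences positive definite, and the rank-one bound is read backwards, with A + y y^T
    as the old matrix. Put h = t L^2. In the upper tail each sample contributes at most lambda_k (h
    + h^2) / L^2 to the exponent, while the threshold takes away lambda_k h (1 + eps) / L^2; with
    eps = 2 h exactly - lambda_k h^2 / L^2 remains, which is the reason for the choice of t. Only
    the products y y^T are known to be measurable, so every integrand is expressed through them. *)

Definition dot n (u v : 'cV[R]_n) : R := (u^T *m v) 0 0.

Lemma dotE n (u v : 'cV[R]_n) : dot u v = \sum_i u i 0 * v i 0.
Proof. by rewrite /dot mxE; apply: eq_bigr => i _; rewrite mxE. Qed.

Lemma dotC n (u v : 'cV[R]_n) : dot u v = dot v u.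
Proof. by rewrite !dotE; apply: eq_bigr => i _; rewrite mulrC. Qed.

Lemma dotDl n (u v w : 'cV[R]_n) : dot (u + v) w = dot u w + dot v w.
Proof. by rewrite /dot linearD /= mulmxDl mxE. Qed.

Lemma dotDr n (u v w : 'cV[R]_n) : dot w (u + v) = dot w u + dot w v.
Proof. by rewrite /dot mulmxDr mxE. Qed.

Lemma dotBr n (u v w : 'cV[R]_n) : dot w (u - v) = dot w u - dot w v.
Proof. by rewrite /dot mulmxBr !mxE. Qed.

Lemma dotZl n a (u v : 'cV[R]_n) : dot (a *: u) v = a * dot u v.
Proof. by rewrite /dot linearZ /= -scalemxAl mxE. Qed.

Lemma dotZr n a (u v : 'cV[R]_n) : dot u (a *: v) = a * dot u v.
Proof. by rewrite /dot -scalemxAr mxE. Qed.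

Lemma dot0l n (v : 'cV[R]_n) : dot 0 v = 0.
Proof. by rewrite /dot trmx0 mul0mx mxE. Qed.

Lemma dot_ge0 n (u : 'cV[R]_n) : 0 <= dot u u.
Proof. by rewrite dotE sumr_ge0 // => i _; rewrite -expr2 sqr_ge0. Qed.

Lemma dot_eq0 n (u : 'cV[R]_n) : (dot u u == 0) = (u == 0).
Proof.
apply/eqP/eqP => [|->]; last by rewrite dot0l.
rewrite dotE => /eqP; rewrite psumr_eq0 => [/allP u0|i _]; last first.
  by rewrite -expr2 sqr_ge0.
apply/colP => i; rewrite mxE; have := u0 i (mem_index_enum _).
by rewrite /= mulf_eq0 orbb => /eqP.
Qed.

Lemma dot_gt0 n (u : 'cV[R]_n) : (0 < dot u u) = (u != 0).
Proof. by rewrite lt_neqAle dot_ge0 andbT eq_sym dot_eq0. Qed.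

Lemma dot_mulmxl m n (A : 'M[R]_(m, n)) u v : dot (A *m u) v = dot u (A^T *m v).
Proof. by rewrite /dot trmx_mul mulmxA. Qed.

Lemma dot_outer n (u v w z : 'cV[R]_n) :
  dot u (v *m w^T *m z) = dot u v * dot w z.
Proof.
by rewrite /dot !mulmxA -[_ *m _ *m z]mulmxA [LHS]mxE big_ord1.
Qed.

Lemma mxtrace_mul_outer n (M : 'M[R]_n) (u v : 'cV[R]_n) :
  \tr (M *m (u *m v^T)) = dot v (M *m u).
Proof. by rewrite mulmxA mxtrace_mulC mulmxA trace_mx11 /dot mulmxA. Qed.

Definition mxge n (c : R) (A : 'M[R]_n) :=
  A^T = A /\ forall z : 'cV_n, c * dot z z <= dot z (A *m z).

Definition mxle n (A : 'M[R]_n) (c : R) :=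
  forall z : 'cV_n, dot z (A *m z) <= c * dot z z.

Lemma psd_CauchySchwarz n (A : 'M[R]_n) u v : mxge 0 A ->
  dot u (A *m v) ^+ 2 <= dot u (A *m u) * dot v (A *m v).
Proof.
move=> [symA psdA].
have q (z : 'cV_n) : 0 <= dot z (A *m z) by have := psdA z; rewrite mul0r.
have E t : dot (u + t *: v) (A *m (u + t *: v)) =
    dot u (A *m u) + t * 2 * dot u (A *m v) + t ^+ 2 * dot v (A *m v).
  rewrite mulmxDr -scalemxAr !(dotDl, dotDr, dotZl, dotZr).
  have -> : dot v (A *m u) = dot u (A *m v).
    by rewrite dotC dot_mulmxl symA.
  by ring.
have [c0|] := eqVneq (dot v (A *m v)) 0.
  rewrite c0 mulr0.
  have [->|b0] := eqVneq (dot u (A *m v)) 0; first by rewrite expr0n.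
  (* Without its quadratic term the form is affine in t, and this t gives it the value -1. *)
  have := q (u + (- (dot u (A *m u) + 1) / (2 * dot u (A *m v))) *: v).
  rewrite E c0 mulr0 addr0.
  have -> : dot u (A *m u) + - (dot u (A *m u) + 1) / (2 * dot u (A *m v)) * 2 *
      dot u (A *m v) = - 1 by field.
  by rewrite oppr_ge0 ler10.
move=> c0; have {}c0 : 0 < dot v (A *m v) by rewrite lt_neqAle eq_sym c0 q.
(* The minimiser of the quadratic in t. *)
have := q (u + (- dot u (A *m v) / dot v (A *m v)) *: v).
rewrite E.
have -> : dot u (A *m u) + - dot u (A *m v) / dot v (A *m v) * 2 *
    dot u (A *m v) + (- dot u (A *m v) / dot v (A *m v)) ^+ 2 *
    dot v (A *m v) =
  (dot u (A *m u) * dot v (A *m v) - dot u (A *m v) ^+ 2) / dot v (A *m v).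
  by field; rewrite gt_eqF.
by rewrite pmulr_lge0 ?invr_gt0 // subr_ge0.
Qed.

Lemma CauchySchwarz n (u v : 'cV[R]_n) : dot u v ^+ 2 <= dot u u * dot v v.
Proof.
have := @psd_CauchySchwarz n 1%:M u v; rewrite !mul1mx; apply.
by split=> [|z]; rewrite ?trmx1 // mul0r mul1mx dot_ge0.
Qed.

Lemma trmxX n (A : 'M[R]_n) p : (A ^+ p)^T = A^T ^+ p.
Proof.
elim: p => [|p IH]; first by rewrite !expr0 trmx1.
by rewrite exprS exprSr -!mulmxE trmx_mul IH.
Qed.

Lemma mxgeW n (c c' : R) (A : 'M[R]_n) : c' <= c -> mxge c A -> mxge c' A.
Proof.
move=> cc [sA gA]; split=> // z; apply: le_trans (gA z).
by rewrite ler_wpM2r ?dot_ge0.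
Qed.

Lemma psdX n (A : 'M[R]_n) p : mxge 0 A -> mxge 0 (A ^+ p).
Proof.
move=> [sA gA].
have sX : (A ^+ p)^T = A ^+ p by rewrite trmxX sA.
(* Positivity climbs two exponents at a time, through z^T A^(p+2) z = (A z)^T A^p (A z), so two
   consecutive powers are carried. *)
suff [gX _] : (forall z : 'cV_n, 0 * dot z z <= dot z (A ^+ p *m z)) /\
    (forall z : 'cV_n, 0 * dot z z <= dot z (A ^+ p.+1 *m z)) by [].
elim: p {sX} => [|p [IH1 IH2]].
  by split=> z; rewrite ?expr0 ?expr1 // mul0r mul1mx dot_ge0.
split=> // z.
have -> : A ^+ p.+2 *m z = A *m (A ^+ p *m (A *m z)).
  by rewrite exprS exprSr -!mulmxE !mulmxA.
by have := IH1 (A *m z); rewrite !mul0r dot_mulmxl sA.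
Qed.

Section moments.
Context {n : nat} (A : 'M[R]_n) (c : R).
Hypotheses (c_gt0 : 0 < c) (Ac : mxge c A).

(** In an eigenbasis of [A] this is the p-th moment of the measure that puts the squared coordinates
    of [y] on the eigenvalues. *)
Definition moment (y : 'cV[R]_n) p : R := dot y (A ^+ p *m y).

Let psdA : mxge 0 A. Proof. exact: mxgeW (ltW c_gt0) Ac. Qed.

Lemma moment0 y : moment y 0 = dot y y.
Proof. by rewrite /moment expr0 mul1mx. Qed.

Lemma momentD y p q : moment y (p + q) = dot (A ^+ p *m y) (A ^+ q *m y).
Proof.
by rewrite /moment dot_mulmxl trmxX (proj1 Ac) exprD -mulmxE mulmxA.
Qed.

Lemma moment_ge0 y p : 0 <= moment y p.
Proof. by have [_ /(_ y)] := psdX p psdA; rewrite mul0r. Qed.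

(** Cauchy-Schwarz for the semidefinite form [A ^+ p], applied to [y] and [A *m y]. *)
Lemma moment_logconvex y p :
  moment y p.+1 ^+ 2 <= moment y p * moment y p.+2.
Proof.
have := psd_CauchySchwarz y (A *m y) (psdX p psdA).
have -> : dot y (A ^+ p *m (A *m y)) = moment y p.+1.
  by rewrite /moment exprSr -mulmxE mulmxA.
have -> // : dot (A *m y) (A ^+ p *m (A *m y)) = moment y p.+2.
rewrite /moment dot_mulmxl (proj1 Ac) exprS exprSr -!mulmxE.
by rewrite !mulmxA.
Qed.

(** By log-convexity the ratio of consecutive moments cannot decrease, and at [p = 0] it is at least
    [c]. *)
Lemma moment_geS y p : c * moment y p <= moment y p.+1.
Proof.
elim: p => [|p IH]; first by rewrite moment0 /moment expr1 (proj2 Ac).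
have := moment_ge0 y p.+1; rewrite le_eqVlt => /predU1P[<-|b_gt0].
  by rewrite mulr0 moment_ge0.
rewrite -(ler_pM2r b_gt0) -mulrA -expr2.
apply: le_trans (ler_wpM2l (ltW c_gt0) (moment_logconvex y p)) _.
by rewrite mulrA mulrC ler_wpM2l // moment_ge0.
Qed.

(** Increasing ratios do not propagate an upper bound upwards. Even exponents follow directly from
    [mxle A K] at [A ^+ r *m y]; an odd one is then bounded by the ratio at the next, even
    exponent. *)
Lemma moment_le K y p : 0 <= K -> mxle A K -> moment y p.+1 <= K * moment y p.
Proof.
move=> K0 AK.
have even r : moment y r.*2.+1 <= K * moment y r.*2.
  have := AK (A ^+ r *m y); rewrite -momentD addnn; apply: le_trans.
  by rewrite -addnn -addnS momentD exprS -mulmxE mulmxA.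
rewrite -(odd_double_half p); case: (odd p); last exact: even.
rewrite add1n; have := moment_ge0 y (p./2.*2.+2).
rewrite le_eqVlt => /predU1P[<-|b_gt0]; first by rewrite mulr_ge0 ?moment_ge0.
rewrite -(ler_pM2r b_gt0) -expr2.
apply: le_trans (moment_logconvex _ _) _.
rewrite -[K * _]mulrC -mulrA ler_wpM2l ?moment_ge0 //.
by have := even p./2.+1; rewrite doubleS.
Qed.

(* The ratios [moment y p.+1 / moment y p] increase with [p]. *)
Lemma moment_mul_le y p q : moment y p * moment y q <= moment y 0 * moment y (p + q).
Proof.
have [->|y0] := eqVneq y 0; first by rewrite /moment !dot0l !mul0r.
have b_gt0 r : 0 < moment y r.
  elim: r => [|r IH]; first by rewrite moment0 dot_gt0.
  by apply: lt_le_trans (moment_geS y r); rewrite mulr_gt0.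
have step i j : moment y i.+1 * moment y (i + j) <= moment y i * moment y (i + j).+1.
  elim: j => [|j IH]; first by rewrite addn0 mulrC.
  rewrite addnS -(ler_pM2r (b_gt0 (i + j)%N)).
  apply: le_trans (_ : moment y i.+1 * moment y (i + j) * moment y (i + j).+1 <= _).
    by rewrite mulrAC.
  apply: le_trans (ler_wpM2r (ltW (b_gt0 _)) IH) _.
  rewrite -!mulrA ler_wpM2l ?(ltW (b_gt0 _)) // -expr2 mulrC.
  exact: moment_logconvex.
wlog le_pq : p q / (p <= q)%N.
  move=> H; have [/H//|/ltnW/H] := leqP p q.
  by rewrite mulrC addnC.
elim: p q le_pq => [//|p IH] q le_pq.
apply: le_trans (_ : moment y p * moment y q.+1 <= _); last first.
  by rewrite addSnnS IH // ltnW // ltnW.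
by have := step p (q - p)%N; rewrite subnKC // ltnW.
Qed.

Lemma mxtrace_moment p : \tr (A ^+ p) = \sum_i moment (delta_mx i 0) p.
Proof.
apply: eq_bigr => i _; rewrite /moment /dot trmx_delta -rowE -colE.
by rewrite !mxE.
Qed.

Lemma mxtraceX_ge0 p : 0 <= \tr (A ^+ p).
Proof. by rewrite mxtrace_moment sumr_ge0 // => i _; exact: moment_ge0. Qed.

Lemma mxtraceX_geS p : c * \tr (A ^+ p) <= \tr (A ^+ p.+1).
Proof.
by rewrite !mxtrace_moment mulr_sumr ler_sum // => i _; exact: moment_geS.
Qed.

Lemma mxtraceX_leS K p : 0 <= K -> mxle A K ->
  \tr (A ^+ p.+1) <= K * \tr (A ^+ p).
Proof.
move=> K0 AK.
by rewrite !mxtrace_moment mulr_sumr ler_sum // => i _; exact: moment_le.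
Qed.

Lemma diag_mxX_ge0 p i : 0 <= (A ^+ p) i i.
Proof.
have := moment_ge0 (delta_mx i 0) p.
by rewrite /moment /dot trmx_delta -rowE -colE !mxE.
Qed.

End moments.

(** The Frobenius norm dominates the operator norm. *)
Lemma dot_mulmx_le m n (M : 'M[R]_(m, n)) (z : 'cV_n) :
  dot (M *m z) (M *m z) <= \tr (M *m M^T) * dot z z.
Proof.
rewrite dotE /mxtrace mulr_suml; apply: ler_sum => i _.
rewrite -expr2.
have -> : (M *m z) i 0 = dot (row i M)^T z.
  by rewrite dotE mxE; apply: eq_bigr => j _; rewrite !mxE.
apply: le_trans (CauchySchwarz _ _) _; rewrite ler_wpM2r ?dot_ge0 //.
by rewrite dotE mxE; apply: ler_sum => j _; rewrite !mxE.
Qed.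

(** A Jensen-type inequality, obtained from [moment_mul_le] with exponents 1 and p, gives t^p |z|^2
    <= z^T A^p z. An even exponent makes the right side |A^r z|^2, which the Frobenius norm of A^r
    bounds by tr A^(2r) |z|^2; no diagonalisation is involved. *)
Lemma expr_le_mxtraceX n (A : 'M[R]_n) (c t : R) (z : 'cV_n) r :
  0 < c -> mxge c A -> 0 <= t -> z != 0 -> t * dot z z <= dot z (A *m z) ->
  t ^+ r.*2 <= \tr (A ^+ r.*2).
Proof.
move=> c0 Ac t0; rewrite -dot_gt0 => z0 tz.
have pow p : t ^+ p * dot z z <= moment A z p.
  elim: p => [|p IH]; first by rewrite expr0 mul1r moment0.
  rewrite -(ler_pM2l z0).
  have := moment_mul_le c0 Ac z 1 p; rewrite moment0 add1n; apply: le_trans.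
  rewrite {1}/moment expr1; apply: le_trans (_ : t * dot z z * moment A z p <= _).
    by rewrite exprS mulrA mulrA [_ * t]mulrC -!mulrA ler_wpM2l // ler_wpM2l // ltW.
  by rewrite ler_wpM2r // (moment_ge0 c0 Ac).
rewrite -(ler_pM2r z0); apply: le_trans (pow _) _.
rewrite -addnn (momentD Ac) exprD -mulmxE.
by have := dot_mulmx_le (A ^+ r) z; rewrite trmxX (proj1 Ac).
Qed.

(** * Trace powers under a rank-one update *)

Section rank_one_update.
Context {n : nat} (A : 'M[R]_n) (y : 'cV[R]_n).
Let B := A + y *m y^T.

(** Telescopes the mixed traces tr (A^(p-i) B^i): neighbours differ by one factor B - A = y y^T, and
    cyclicity turns the difference into a quadratic form in [y]. *)
Lemma mxtraceX_rank_one p : \tr (B ^+ p) =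
  \tr (A ^+ p) + \sum_(i < p) dot y (B ^+ i *m (A ^+ (p.-1 - i) *m y)).
Proof.
pose u i := \tr (A ^+ (p - i) *m B ^+ i).
have -> : \tr (B ^+ p) = u p by rewrite /u subnn mul1mx.
have -> : \tr (A ^+ p) = u 0 by rewrite /u subn0 mulmx1.
apply/eqP; rewrite addrC -subr_eq -telescope_sumr //; apply/eqP.
rewrite big_mkord; apply: eq_bigr => i _; rewrite /u.
have -> : (p - i = (p.-1 - i).+1)%N.
  by rewrite -subSn; case: (p) i => [[]|p'] // i; rewrite -ltnS.
have -> : (p - i.+1 = p.-1 - i)%N by rewrite -subn1 -subnDA add1n.
rewrite (exprS B) (exprSr A) -!mulmxE -!mulmxA -linearB /= -mulmxBr -mulmxBl.
rewrite /B [in X in _ *m (X *m _)]addrC addKr -/B mxtrace_mulC -mulmxA.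
by rewrite mxtrace_mulC mxtrace_mul_outer mulmxA.
Qed.

Context (c a : R).
Hypotheses (c_gt0 : 0 < c) (Ac : mxge c A) (ya : dot y y <= a).

Lemma dot_rank_oneX p i : dot y (B ^+ i *m (A ^+ p *m y)) =
  dot y (A ^+ p *m (B ^+ i *m y)).
Proof.
have sB : B^T = B by rewrite /B linearD /= trmx_mul trmxK (proj1 Ac).
by rewrite dotC dot_mulmxl trmxX sB dot_mulmxl trmxX (proj1 Ac).
Qed.

Let expand p i : dot y (A ^+ p *m (B ^+ i.+1 *m y)) =
  dot y (A ^+ p.+1 *m (B ^+ i *m y)) + moment A y p * dot y (B ^+ i *m y).
Proof.
rewrite exprS -mulmxE -!mulmxA {1}/B mulmxDl mulmxDr dotDr; congr (_ + _).
  by rewrite exprSr -mulmxE !mulmxA.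
rewrite -[y *m _ *m _]mulmxA.
by rewrite [_ *m (y *m _)]mulmxA /moment -[A ^+ p *m y *m _]mulmxA mulmxA /dot
  !mulmxA -[_ *m _ *m y]mulmxA -[_ *m _ *m (_ *m y)]mulmxA [LHS]mxE big_ord1 !mulmxA.
Qed.

Lemma rank_oneX_ge p i :
  moment A y (p + i) <= dot y (A ^+ p *m (B ^+ i *m y)).
Proof.
elim: i p => [|i IH] p; first by rewrite addn0 expr0 mul1mx.
rewrite expand addnS -addSn -[leLHS]addr0 lerD // mulr_ge0 //.
  exact: moment_ge0 c_gt0 Ac _ _.
have := IH 0; rewrite expr0 mul1mx; apply: le_trans.
exact: moment_ge0 c_gt0 Ac _ _.
Qed.

(** Expanding one factor [B] adds the product of moment p of [A] with y^T B^i y. By induction this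
    involves b_p b_i <= b_0 b_(p+i) <= a b_(p+i) <= (a / c) b_(p+i+1), so each factor [B] costs at
    most 1 + a / c. The first of these inequalities is where log-convexity enters. *)
Lemma rank_oneX_le p i : dot y (A ^+ p *m (B ^+ i *m y)) <=
  (1 + a / c) ^+ i * moment A y (p + i).
Proof.
have a0 : 0 <= a := le_trans (dot_ge0 y) ya.
have r0 : 0 <= 1 + a / c by rewrite addr_ge0 // divr_ge0 // ltW.
have b0 := moment_ge0 c_gt0 Ac y.
elim: i p => [|i IH] p; first by rewrite addn0 !expr0 !mul1mx mul1r.
rewrite expand addnS -addSn (exprSr (1 + a / c)) -mulrA mulrDl mul1r mulrDr lerD //.
have := IH 0; rewrite expr0 mul1mx add0n => IH0.
apply: le_trans (ler_wpM2l (b0 p) IH0) _.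
rewrite mulrCA ler_wpM2l ?exprn_ge0 //.
apply: le_trans (moment_mul_le c_gt0 Ac y _ _) _.
rewrite moment0; apply: le_trans (ler_wpM2r (b0 _) ya) _.
rewrite -mulrA ler_wpM2l // ler_pdivlMl //; exact: moment_geS.
Qed.

Lemma mxtraceX_rank_one_le p : \tr (B ^+ p) <=
  \tr (A ^+ p) + (\sum_(i < p) (1 + a / c) ^+ i) * moment A y p.-1.
Proof.
rewrite mxtraceX_rank_one lerD2l mulr_suml; apply: ler_sum => i _.
rewrite dot_rank_oneX; apply: le_trans (rank_oneX_le _ _) _.
by rewrite subnK //; case: (p) i => [[]|p'] // i; rewrite -ltnS.
Qed.

(** The increment is bounded through moments of [B], not of [A]: when a sample is subtracted, [B] is
    the matrix known beforehand. Passing from [A] to [B] costs the factor (1 + a / c)^(p-1). *)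
Lemma mxtraceX_rank_one_ge p : \tr (A ^+ p) +
  p%:R * ((1 + a / c) ^+ p.-1)^-1 * moment B y p.-1 <= \tr (B ^+ p).
Proof.
have a0 : 0 <= a := le_trans (dot_ge0 y) ya.
have r0 : 0 < 1 + a / c by rewrite ltr_pwDl // divr_ge0 // ltW.
rewrite mxtraceX_rank_one lerD2l -mulrA mulr_natl.
rewrite -[X in _ *+ X]card_ord -sumr_const; apply: ler_sum => i _.
rewrite dot_rank_oneX; apply: le_trans (rank_oneX_ge _ _).
rewrite subnK; last by case: (p) i => [[]|p'] // i; rewrite -ltnS.
rewrite ler_pdivrMl ?exprn_gt0 //.
by have := rank_oneX_le 0 p.-1; rewrite expr0 mul1mx.
Qed.

End rank_one_update.
End quadratic_forms.

(** * Spectral theorem and Courant-Fischer *)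

Section spectral_theorem.
Context {R : rcfType}.

Lemma char_poly_conj n (P Q A : 'M[R]_n) : P *m Q = 1%:M ->
  char_poly (P *m A *m Q) = char_poly A.
Proof.
move=> PQ; have PQ' : map_mx polyC P *m map_mx polyC Q = 1%:M.
  by rewrite -map_mxM PQ map_mx1.
rewrite /char_poly /char_poly_mx.
have -> : 'X%:M - map_mx polyC (P *m A *m Q) =
    map_mx polyC P *m ('X%:M - map_mx polyC A) *m map_mx polyC Q.
  rewrite mulmxBr mulmxBl !map_mxM /= scalar_mxC; congr (_ - _).
  by rewrite -mulmxA PQ' mulmx1.
rewrite !det_mulmx mulrAC -det_mulmx PQ' det1 mul1r //.
Qed.

(* Householder's reflection *)
Lemma reflection_exists n (e u : 'cV[R]_n) : dot e e = 1 -> dot u u = 1 ->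
  exists H : 'M[R]_n, [/\ H^T = H, H *m H = 1%:M & H *m e = u].
Proof.
move=> e1 u1; have [<-|ne] := eqVneq e u.
  by exists 1%:M; rewrite trmx1 !mul1mx.
pose w := u - e; pose s := dot w w.
have s0 : s != 0 by rewrite dot_eq0 subr_eq0 eq_sym.
have ww : w^T *m w = s%:M by rewrite [LHS]mx11_scalar.
have se : s = 2 - 2 * dot u e.
  by rewrite /s /w dotBr 2!(dotC (u - e)) !dotBr e1 u1 (dotC e u); ring.
have we : w^T *m e = (- s / 2)%:M.
  rewrite [LHS]mx11_scalar; congr (_%:M); rewrite -/(dot w e) dotC dotBr e1.
  by rewrite se (dotC e u); field.
exists (1%:M - (2 / s) *: (w *m w^T)); split.
- by rewrite linearB linearZ /= trmx1 trmx_mul trmxK.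
- set B := _ *: _.
  have BB : B *m B = B + B.
    rewrite /B -scalemxAl -scalemxAr mulmxA -[w *m w^T *m w]mulmxA ww.
    rewrite mul_mx_scalar -scalemxAl !scalerA -scalerDl; congr (_ *: _).
    by field.
  by rewrite mulmxBr mulmx1 mulmxBl mul1mx BB opprB addrK subrK.
- rewrite mulmxBl mul1mx -scalemxAl -mulmxA we mul_mx_scalar scalerA.
  have -> : 2 / s * (- s / 2) = - 1 by field.
  by rewrite scaleN1r opprK /w addrC subrK.
Qed.

(** Deflation: the reflection that sends the first basis vector to a unit eigenvector for [l] splits
    off a 1 x 1 block. Taking the roots as a given sequence fixes the order of the diagonal. *)
Lemma spectral_theorem n (A : 'M[R]_n) (s : seq R) : A^T = A ->
  char_poly A = \prod_(l <- s) ('X - l%:P) ->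
  exists2 Q : 'M[R]_n, Q^T *m Q = 1%:M &
    A = Q *m diag_mx (\row_i s`_i) *m Q^T.
Proof.
elim: n A s => [|n IH] A s sA cA.
  by exists 1%:M; rewrite ?trmx1 ?mulmx1 //; apply/matrixP; case.
have sz : size s = n.+1.
  by apply: succn_inj; rewrite -(size_char_poly A) cA size_prod_XsubC.
case: s sz cA => // l s [sz] cA.
have : eigenvalue A l.
  by rewrite eigenvalue_root_char cA root_prod_XsubC inE eqxx.
move=> /eigenvalueP[v vA v0].
pose u := (Num.sqrt (dot v^T v^T))^-1 *: v^T.
have vv : 0 < dot v^T v^T by rewrite dot_gt0 trmx_eq0.
have u1 : dot u u = 1.
  rewrite /u dotZl dotZr mulrA -expr2 exprVn sqr_sqrtr ?ltW //.
  by rewrite mulVf // gt_eqF.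
have Au : A *m u = l *: u.
  rewrite /u -scalemxAr scalerA mulrC -scalerA; congr (_ *: _).
  by rewrite -{1}sA -trmx_mul vA linearZ.
pose e : 'cV[R]_(1 + n) := delta_mx 0 0.
have e1 : dot e e = 1.
  rewrite dotE (bigD1 0) //= big1 ?addr0 ?mxE ?eqxx ?mul1r //.
  by move=> i i0; rewrite mxE (negbTE i0) mul0r.
have [H [sH HH He]] := reflection_exists e1 u1.
have [A1 defA1] : exists A1 : 'M[R]_(1 + n), A1 = H *m A *m H.
  by exists (H *m A *m H).
have sA1 : A1^T = A1 by rewrite defA1 !trmx_mul sH sA mulmxA.
have A1e : A1 *m e = l *: e.
  by rewrite defA1 -mulmxA He -mulmxA Au -scalemxAr -He mulmxA HH mul1mx.
have A1i i : A1 i 0 = l * (i == 0)%:R.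
  by have /colP/(_ i) := A1e; rewrite -colE !mxE eqxx andbT.
pose A' : 'M[R]_n := drsubmx A1.
have dl : dlsubmx A1 = 0.
  apply/matrixP => i j; rewrite !mxE ord1.
  have -> : lshift n 0 = 0 :> 'I_(1 + n) by exact: val_inj.
  by rewrite A1i mulr0.
have A1E : A1 = block_mx l%:M 0 0 A'.
  rewrite -[LHS]submxK; congr block_mx => //; 
    last by rewrite -[LHS]trmxK trmx_ursub sA1 dl trmx0.
  apply/matrixP => i j; rewrite !mxE !ord1.
  have -> : lshift n 0 = 0 :> 'I_(1 + n) by exact: val_inj.
  by rewrite A1i !eqxx mulr1.
have sA' : A'^T = A' by rewrite /A' trmx_drsub sA1.
have cA' : char_poly A' = \prod_(l <- s) ('X - l%:P).
  apply: (@mulfI _ ('X - l%:P)); first by rewrite polyXsubC_eq0.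
  rewrite big_cons in cA; rewrite -cA -(char_poly_conj A HH).
  have -> : char_poly (H *m A *m H) = char_poly (block_mx (l%:M : 'M[R]_1) 0 0 A').
    by rewrite -A1E defA1.
  rewrite /char_poly char_block_diag_mx det_lblock; congr (_ * _).
  by rewrite /char_poly_mx map_scalar_mx -raddfB det_scalar1.
have [Q QQ AQ] := IH _ _ sA' cA'.
pose D := diag_mx (\row_i s`_i) : 'M[R]_n.
pose B : 'M[R]_(1 + n) := block_mx 1%:M 0 0 Q.
have trB : B^T = block_mx 1%:M 0 0 Q^T by rewrite tr_block_mx !trmx0 trmx1.
have BB : B^T *m B = 1%:M.
  rewrite trB mulmx_block !(mulmx0, mul0mx, addr0, add0r, mulmx1).
  by rewrite QQ -scalar_mx_block.
have BDB : A1 = B *m block_mx l%:M 0 0 D *m B^T.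
  rewrite trB A1E AQ !mulmx_block.
  by rewrite !(mulmx0, mul0mx, addr0, add0r, mulmx1, mul1mx).
have DE : diag_mx (\row_i (l :: s)`_i) =
    block_mx (l%:M : 'M[R]_1) 0 0 D :> 'M[R]_(1 + n).
  apply/matrixP => i j.
  case: (split_ordP i) => i' ->; case: (split_ordP j) => j' ->.
  - by rewrite block_mxEul !mxE !ord1.
  - by rewrite block_mxEur !mxE ord1 -val_eqE /= mulr0n.
  - by rewrite block_mxEdl !mxE -val_eqE /= ord1 mulr0n.
  - by rewrite block_mxEdr !mxE /= -!val_eqE /= eqn_add2l.
exists (H *m B).
  by rewrite trmx_mul sH mulmxA -[_ *m H *m H]mulmxA HH mulmx1.
have -> : A = H *m A1 *m H.
  by rewrite defA1 !mulmxA HH mul1mx -mulmxA HH mulmx1.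
by rewrite trmx_mul sH DE BDB !mulmxA.
Qed.

End spectral_theorem.

Section Courant_Fischer.
Context {R : realType} {m : nat}.
Variables (A : 'M[R]_m) (l : nat -> R).
Hypotheses (symA : A^T = A) (eigA : eigenvalues_desc A l).

Lemma spectral_desc : exists2 Q : 'M[R]_m, Q^T *m Q = 1%:M &
  A = Q *m diag_mx (\row_(i < m) l i.+1) *m Q^T.
Proof.
have [|Q QQ AQ] := @spectral_theorem R m A [seq l i | i <- iota 1 m] symA.
  by rewrite (proj1 eigA) big_map /index_iota subn1.
exists Q => //; rewrite {1}AQ; congr (_ *m diag_mx _ *m _).
apply/rowP => i; rewrite !mxE (nth_map 0) ?size_iota //.
by rewrite nth_iota // add1n.
Qed.

(** Dimension count: in eigencoordinates a matrix of rank below [r] has a nonzero kernel vector in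
    the r-dimensional range of [V]. The choice of [P] decides which eigencoordinates [c] vanish. *)
Lemma quadratic_form_subspace r (V : 'M[R]_(m, r)) (P : 'M[R]_m) :
  V^T *m V = 1%:M -> (\rank P < r)%N ->
  exists z (c : 'cV[R]_m), [/\ z != 0, P *m c = 0, dot z z = dot c c &
    dot z (V^T *m A *m V *m z) = \sum_(i < m) l i.+1 * (c i 0) ^+ 2].
Proof.
move=> VV rP; have [Q QQ AQ] := spectral_desc.
have QQ' : Q *m Q^T = 1%:M by exact: mulmx1C.
pose M := P *m Q^T *m V.
have : kermx M^T != 0.
  rewrite -mxrank_eq0 mxrank_ker mxrank_tr -lt0n subn_gt0.
  by rewrite /M -mulmxA (leq_ltn_trans (mxrankM_maxl _ _)).
move=> /rowV0Pn[v /sub_kermxP vM v0].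
exists v^T, (Q^T *m V *m v^T); split.
- by rewrite trmx_eq0.
- by apply: trmx_inj; rewrite trmx0 -vM /M !trmx_mul !trmxK !mulmxA.
- rewrite /dot !trmx_mul !trmxK !mulmxA -[_ *m Q *m Q^T]mulmxA QQ' mulmx1.
  by rewrite -[_ *m V^T *m V]mulmxA VV mulmx1.
- set c := Q^T *m V *m v^T.
  have -> : dot v^T (V^T *m A *m V *m v^T) =
      dot c (diag_mx (\row_(i < m) l i.+1) *m c).
    by rewrite /dot /c {1}AQ !trmx_mul !trmxK !mulmxA.
  rewrite dotE; apply: eq_bigr => i _.
  by rewrite mul_diag_mx !mxE mulrCA -expr2.
Qed.

Lemma Courant_Fischer_ge k r (V : 'M[R]_(m, r)) : V^T *m V = 1%:M ->
  (1 <= k <= m)%N -> (m - k < r)%N ->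
  exists2 z : 'cV[R]_r, z != 0 &
    l k * dot z z <= dot z (V^T *m A *m V *m z).
Proof.
move=> VV /andP[k1 km] kr.
(* Coordinate [i] belongs to [l i.+1]; [copid_mx k], of rank m - k, leaves only [l 1], ...,
   [l k]. *)
have [|z [c [z0 Pc Ez Eq]]] := @quadratic_form_subspace r V (copid_mx k) VV.
  by rewrite rank_copid_mx.
exists z => //; rewrite Eq Ez dotE mulr_sumr; apply: ler_sum => i _; rewrite -expr2.
have [ik|ik] := ltnP i k.
  by rewrite ler_wpM2r ?sqr_ge0 // (proj2 eigA).
suff -> : c i 0 = 0 by rewrite expr0n !mulr0.
have /colP/(_ i) := Pc; rewrite mxE (bigD1 i) //= big1 => [|j ji].
  by rewrite !mxE !eqxx ltnNge ik /= subr0 mul1r addr0.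
by rewrite !mxE val_eqE eq_sym (negbTE ji) /= subr0 mul0r.
Qed.

Lemma Courant_Fischer_le k r (V : 'M[R]_(m, r)) : V^T *m V = 1%:M ->
  (1 <= k <= m)%N -> (k <= r)%N ->
  exists2 z : 'cV[R]_r, z != 0 &
    dot z (V^T *m A *m V *m z) <= l k * dot z z.
Proof.
move=> VV /andP[k1 km] kr.
have k1m : (k.-1 <= m)%N by rewrite (leq_trans (leq_pred _)).
(* Killing the first k - 1 coordinates leaves only [l k], ..., [l m]. *)
have [|z [c [z0 Pc Ez Eq]]] := @quadratic_form_subspace r V (pid_mx k.-1) VV.
  by rewrite rank_pid_mx // prednK.
exists z => //; rewrite Eq Ez dotE mulr_sumr; apply: ler_sum => i _; rewrite -expr2.
have [ik|ik] := leqP k.-1 i.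
  by rewrite ler_wpM2r ?sqr_ge0 // (proj2 eigA) // -(prednK k1) ltnS.
suff -> : c i 0 = 0 by rewrite expr0n !mulr0.
have /colP/(_ i) := Pc; rewrite mxE (bigD1 i) //= big1 => [|j ji].
  by rewrite !mxE eqxx ik /= mul1r addr0.
by rewrite !mxE val_eqE eq_sym (negbTE ji) /= mul0r.
Qed.

Lemma orthonormal_eigenvectors r (f : 'I_r -> 'I_m) : injective f ->
  exists2 V : 'M[R]_(m, r), V^T *m V = 1%:M &
    V^T *m A *m V = diag_mx (\row_j l (f j).+1).
Proof.
move=> injf; have [Q QQ AQ] := spectral_desc.
(* Serves both claims: [B = 1%:M] gives orthonormality, and the diagonal matrix of eigenvalues gives
   the compression of [A]. *)
have D (B : 'M[R]_m) : (colsub f Q)^T *m Q *m B *m (Q^T *m colsub f Q) =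
    mxsub f f B.
  have QV : Q^T *m colsub f Q = colsub f 1%:M.
    rewrite -QQ; apply/matrixP => i j; rewrite !mxE.
    by apply: eq_bigr => h _; rewrite !mxE.
  have -> : (colsub f Q)^T *m Q = rowsub f 1%:M.
    apply: trmx_inj; rewrite trmx_mul trmxK QV.
    by apply/matrixP => i j; rewrite !mxE eq_sym.
  rewrite QV; apply/matrixP => i j; rewrite !mxE (bigD1 (f j)) //= big1.
    rewrite !mxE eqxx mulr1 addr0 (bigD1 (f i)) //= big1.
      by rewrite !mxE eqxx mul1r addr0.
    by move=> h hi; rewrite !mxE eq_sym (negbTE hi) mul0r.
  by move=> h hi; rewrite !mxE (negbTE hi) mulr0.
exists (colsub f Q).
  have := D 1%:M; rewrite mulmx1 mulmxA -[_ *m Q *m Q^T]mulmxA.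
  rewrite (mulmx1C QQ) mulmx1 => ->.
  by apply/matrixP => i j; rewrite !mxE (inj_eq injf).
rewrite {1}AQ !mulmxA; have := D (diag_mx (\row_(i < m) l i.+1)).
rewrite !mulmxA => ->.
by apply/matrixP => i j; rewrite !mxE (inj_eq injf).
Qed.

(** Makes the power sums of the eigenvalues polynomial in the entries of [A], from which the
    measurability of the eigenvalues is derived. *)
Lemma mxtraceX_eigenvalues p : \tr (A ^+ p) = \sum_(1 <= i < m.+1) l i ^+ p.
Proof.
have [Q QQ AQ] := spectral_desc; have QQ' := mulmx1C QQ.
have -> : A ^+ p = Q *m diag_mx (\row_(i < m) l i.+1 ^+ p) *m Q^T.
  elim: p => [|p IH].
    rewrite expr0 (_ : \row_i _ = const_mx 1) ?diag_const_mx ?mulmx1 ?QQ' //.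
    by apply/rowP => i; rewrite !mxE expr0.
  rewrite exprSr IH -mulmxE {1}AQ !mulmxA -[_ *m Q^T *m Q]mulmxA QQ mulmx1.
  congr (_ *m _); rewrite -mulmxA mulmx_diag; congr (_ *m diag_mx _).
  by apply/rowP => i; rewrite !mxE exprSr.
rewrite mxtrace_mulC mulmxA QQ mul1mx mxtrace_diag big_add1 /= big_mkord.
by apply: eq_bigr => i _; rewrite mxE.
Qed.

Lemma eigenvalue_ge0 k : mxge 0 A -> (1 <= k <= m)%N -> 0 <= l k.
Proof.
move=> [_ gA] /andP[k1 km].
have [z z0 zl] := @Courant_Fischer_le k m 1%:M (etrans (mulmx1 _) (trmx1 _ _)) 
  (introT andP (conj k1 km)) km.
move: zl; rewrite trmx1 mul1mx mulmx1 => /(le_trans (gA z)).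
by rewrite mul0r pmulr_lge0 // dot_gt0.
Qed.

End Courant_Fischer.

(** * Integration over independent samples *)

Section measurable_matrices.
Context {d : measure_display} {T : measurableType d} {R : realType}.

(** Entrywise, which spares a sigma-algebra on matrices. *)
Definition measurable_mx m n (f : T -> 'M[R]_(m, n)) :=
  forall i j, measurable_fun [set: T] (fun x => f x i j).

Lemma measurable_mx_cst m n (A : 'M[R]_(m, n)) : measurable_mx (fun=> A).
Proof. by move=> i j; exact: measurable_cst. Qed.

Lemma measurable_mxD m n (f g : T -> 'M[R]_(m, n)) :
  measurable_mx f -> measurable_mx g -> measurable_mx (fun x => f x + g x).
Proof.
move=> mf mg i j; under eq_fun do rewrite mxE.
by apply: measurable_funD; [exact: mf|exact: mg].
Qed.

Lemma measurable_mxZ m n (c : R) (f : T -> 'M[R]_(m, n)) :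
  measurable_mx f -> measurable_mx (fun x => c *: f x).
Proof.
move=> mf i j; under eq_fun do rewrite mxE.
by apply: measurable_funM; [exact: measurable_cst|exact: mf].
Qed.

Lemma measurable_mx_sum m n I (s : seq I) (p : pred I) (f : I -> T -> 'M[R]_(m, n)) :
  (forall i, p i -> measurable_mx (f i)) ->
  measurable_mx (fun x => \sum_(i <- s | p i) f i x).
Proof.
move=> mf; elim: s => [|i s IH].
  rewrite (_ : (fun y => _) = fun=> 0); first exact: measurable_mx_cst.
  by apply/funext => y; rewrite big_nil.
rewrite (_ : (fun y => _) = if p i
    then fun y => f i y + \sum_(i <- s | p i) f i y
    else fun y => \sum_(i <- s | p i) f i y); last first.
  by apply/funext => y; rewrite big_cons; case: ifP.
by case: ifPn => // pi; apply: measurable_mxD => //; exact: mf.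
Qed.

Lemma measurable_mxM m n p (f : T -> 'M[R]_(m, n)) (g : T -> 'M[R]_(n, p)) :
  measurable_mx f -> measurable_mx g -> measurable_mx (fun x => f x *m g x).
Proof.
move=> mf mg i j; under eq_fun do rewrite mxE.
by apply: measurable_sum => k; apply: measurable_funM; [exact: mf|exact: mg].
Qed.

Lemma measurable_mxX n (f : T -> 'M[R]_n) p :
  measurable_mx f -> measurable_mx (fun x => f x ^+ p).
Proof.
move=> mf; elim: p => [|p IH].
  rewrite (_ : (fun y => _) = fun=> 1); first exact: measurable_mx_cst.
  by apply/funext => y; rewrite expr0.
rewrite (_ : (fun y => _) = fun y => f y *m f y ^+ p).
  exact: measurable_mxM.
by apply/funext => y; rewrite exprS.
Qed.

Lemma measurable_mxtrace n (f : T -> 'M[R]_n) :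
  measurable_mx f -> measurable_fun [set: T] (fun x => \tr (f x)).
Proof. by move=> mf; apply: measurable_sum => i; exact: mf. Qed.

End measurable_matrices.

Lemma measurable_mx_comp d1 d2 (T1 : measurableType d1) (T2 : measurableType d2)
    (R : realType) m n (f : T2 -> 'M[R]_(m, n)) (g : T1 -> T2) :
  measurable_mx f -> measurable_fun [set: T1] g -> measurable_mx (f \o g).
Proof.
move=> mf mg i j.
by have := measurableT_comp (mf i j) mg.
Qed.

Section independence.
Context {d d' : measure_display} {W : measurableType d} {T : measurableType d'}
  {R : realType} {P : probability W R} {N : nat} (x : 'I_N -> {RV P >-> T}).
Hypothesis indep : independent_RVs x.

(* A pi-system generating the sigma-algebra of the samples before [j]. *)
Definition past (j : nat) : set (set W) :=
  [set E | exists2 A : 'I_N -> set T, (forall i, measurable (A i)) &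
    E = \bigcap_(i in [set i : 'I_N | (i < j)%N]) x i @^-1` A i].

Lemma past_measurable j : past j `<=` @measurable d W.
Proof.
move=> _ [A mA ->]; apply: fin_bigcap_measurable => // i _.
by rewrite -[X in measurable X]setTI; exact: measurable_funP.
Qed.

Lemma setI_closed_past j : setI_closed (past j).
Proof.
move=> _ _ [A mA ->] [B mB ->]; exists (fun i => A i `&` B i).
  by move=> i; exact: measurableI.
by apply/seteqP; split => [w [Aw Bw] i ij|w ABw];
  [split; [exact: Aw|exact: Bw]|split=> i /ABw[]].
Qed.

Lemma past_setT j : past j setT.
Proof.
exists (fun=> setT) => //; apply/seteqP; split=> // w _ i _ //.
Qed.

(** In [E], both sides are finite measures; they agree on the pi-system [past j], which contains the
    whole space, hence on the sigma-algebra it generates. *)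
Lemma past_indep (j : 'I_N) (E : set W) (B : set T) :
  <<s past j >> E -> measurable B ->
  P (E `&` x j @^-1` B) = (P E * P (x j @^-1` B))%E.
Proof.
move=> pE mB.
have mF : measurable (x j @^-1` B).
  by rewrite -[X in measurable X]setTI; exact: measurable_funP.
have [pF pFE] : exists pF : {nonneg R}, pF%:num%:E = P (x j @^-1` B).
  exists (NngNum (fine_ge0 (measure_ge0 P (x j @^-1` B)))).
  by rewrite /= fineK // fin_num_measure.
transitivity (mscale pF P E); last by rewrite -pFE muleC.
transitivity (mrestr P mF E); first by [].
apply: (g_sigma_algebra_measure_unique (past j) _ (fun=> setT)) pE => //.
- exact: past_measurable.
- by move=> _; exact: past_setT.
- by rewrite bigcup_const.
- exact: setI_closed_past.
- move=> A [C mC ->]; transitivity (P (x j @^-1` B) *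
    P (\bigcap_(i in [set i : 'I_N | (i < j)%N]) x i @^-1` C i))%E;
    last by rewrite -pFE.
  have := indep [set i : 'I_N | (i < j)%N]%SET mC.
  (* Independence of the samples up to [j] included, with [B] in position [j], is compared with
     independence of those before [j]. *)
  pose C' i := if i == j then B else C i.
  have mC' i : measurable (C' i) by rewrite /C'; case: ifP.
  have := indep [set i : 'I_N | (i <= j)%N]%SET mC'.
  have C'j : C' j = B by rewrite /C' eqxx.
  rewrite (bigD1 j) ?inE //= C'j.
  have -> : (\prod_(i in [set i : 'I_N | (i <= j)%N]%SET | i != j)
      P (x i @^-1` C' i) = \prod_(i in [set i : 'I_N | (i < j)%N]%SET)
      P (x i @^-1` C i))%E.
    apply: eq_big => [i|i]; rewrite !inE.
      by rewrite ltn_neqAle andbC.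
    by move=> /andP[_ /negbTE ij]; rewrite /C' ij.
  have -> : \bigcap_(j0 in [set j0 | j0 \in [set i : 'I_N | (i <= j)%N]%SET])
      x j0 @^-1` C' j0 = (\bigcap_(i in [set i : 'I_N | (i < j)%N]) x i @^-1` C i)
      `&` x j @^-1` B.
    apply/seteqP; split => [w Cw|w [Cw Bw] i /=].
      split=> [i ij|].
        have := Cw i; rewrite /= inE /C' ltnW // => /(_ isT).
        by case: eqP => // ij'; move: ij; rewrite /= ij' ltnn.
      by have := Cw j; rewrite /= inE /C' eqxx; apply.
    rewrite inE /C'; case: eqVneq => [-> //|nij] ij; apply: Cw.
    by rewrite /= ltn_neqAle nij.
  have -> : \bigcap_(j0 in [set j0 | j0 \in [set i : 'I_N | (i < j)%N]%SET])
      x j0 @^-1` C j0 = \bigcap_(i in [set i : 'I_N | (i < j)%N]) x i @^-1` C i.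
    apply/seteqP; split=> w Cw i /=; first by move=> ij; apply: Cw; rewrite /= inE.
    by rewrite inE => ij; exact: Cw.
  by move=> PB PC; apply: etrans PB _; rewrite PC.
- move=> k; rewrite /= /mrestr setTI.
  exact: le_lt_trans (probability_le1 _ mF) (ltry _).
Qed.

Local Notation past_type j := (g_sigma_algebraType (past j)).

(** The identity as a random variable with values in the coarser measurable space: its law is [P]
    restricted to the past, so the past can be one factor of a product measure. *)
Definition to_past (j : nat) : W -> past_type j := id.

Lemma measurable_to_past j : measurable_fun [set: W] (@to_past j).
Proof.
move=> _ E mE; rewrite setTI.
have := smallest_sub (@sigma_algebra_measurable _ W) (@past_measurable j).
exact.
Qed.

HB.instance Definition _ j := isMeasurableFun.Build _ _ _ _ (@to_past j)
  (measurable_to_past (j := j)).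

Lemma measurable_from_past (i : 'I_N) j : (i < j)%N ->
  measurable_fun [set: past_type j] (x i : past_type j -> T).
Proof.
move=> ij _ B mB; rewrite setTI; apply: sub_sigma_algebra.
exists (fun k => if k == i then B else setT); first by move=> k; case: ifP.
apply/seteqP; split=> [w Bw k /= _|w /(_ i ij)]; last by rewrite /= eqxx.
by case: eqP => [->|].
Qed.

(* Given the samples before [j], sample [j] keeps its law. *)
Lemma integral_past (j : 'I_N) (F : past_type j * T -> \bar R) :
  measurable_fun [set: past_type j * T] F -> (forall p, 0 <= F p)%E ->
  (\int[P]_w F (w, x j w) =
   \int[P]_w \int[distribution P (x j)]_t F (w, t))%E.
Proof.
move=> mF F0.
pose m1 := distribution P (@to_past j).
pose m2 := distribution P (x j).
pose pr : W -> past_type j * T := fun w => (w, x j w).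
have mpr : measurable_fun [set: W] pr.
  apply/measurable_fun_pairP; split; first exact: measurable_to_past.
  exact: measurable_funP.
pose pr' : {mfun W >-> (past_type j * T)%type} :=
  HB.pack pr (isMeasurableFun.Build _ _ _ _ pr mpr).
(* Independence identifies the joint law of the past and sample [j] with the product of their laws;
   Tonelli then integrates the sample first. *)
have law (E : set (past_type j * T)) : measurable E ->
    (m1 \x m2)%E E = distribution P pr' E.
  by apply: product_measure_unique => A B mA mB; exact: past_indep.
transitivity (\int[distribution P pr']_p F p)%E.
  by rewrite ge0_integral_distribution.
transitivity (\int[m1 \x m2]_p F p)%E.
  by apply/esym/eq_measure_integral => A mA _; exact: law.
rewrite fubini_tonelli1 //= ge0_integral_distribution //.
  exact: measurable_fun_fubini_tonelli_F.
by move=> w; apply: integral_ge0 => t _; exact: F0.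
Qed.

Lemma measurable_integral_past (j : 'I_N) (F : past_type j * T -> \bar R) :
  measurable_fun [set: past_type j * T] F -> (forall p, 0 <= F p)%E ->
  measurable_fun [set: W] (fun w => \int[distribution P (x j)]_t F (w, t))%E.
Proof.
move=> mF F0.
have mG := measurable_fun_fubini_tonelli_F (m2 := distribution P (x j)) F mF F0.
exact: measurableT_comp mG (@measurable_to_past j).
Qed.

End independence.

(** * Integration against a law with a density *)

Section density.
Context {d : measure_display} {T : measurableType d} {R : realType}.
Variables (mu : {sigma_finite_measure set T -> \bar R}).
Variables (nu : probability T R) (rho : T -> R).
Hypothesis mrho : measurable_fun [set: T] rho.
Hypothesis nuE :
  forall A, measurable A -> (nu A = \int[mu]_(x in A) (rho x)%:E)%E.

Lemma density_integral f : nu.-integrable [set: T] f ->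
  (\int[nu]_x f x = \int[mu]_x (f x * (rho x)%:E))%E.
Proof.
move=> intf; have mf := measurable_int _ intf.
have dom : nu `<< mu.
  move=> A A0 B mB BA; rewrite nuE //; apply: null_set_integral => //.
    by apply/measurable_EFinP; exact: measurable_funTS.
  exact: A0 B mB BA.
rewrite -(Radon_Nikodym_change_of_variables dom) //.
have domC : charge_of_finite_measure nu `<< mu by exact: dom.
have intRN := Radon_Nikodym_integrable domC.
apply: ae_eq_integral => //.
- by apply: emeasurable_funM => //; exact: measurable_int intRN.
- by apply: emeasurable_funM => //; apply/measurable_EFinP.
- apply: ae_eqe_mul2l; apply: integral_ae_eq => //.
  + exact/measurable_EFinP.
  + by move=> A _ mA; rewrite -nuE // -Radon_Nikodym_integral.
Qed.

End density.

(** * Iterating a one-sample trace bound *)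

Section iteration.
Context {d d' : measure_display} {W : measurableType d} {T : measurableType d'}
  {R : realType} {P : probability W R} {N : nat} (x : 'I_N -> {RV P >-> T}).
Hypothesis indep : independent_RVs x.
Context {n : nat} (A0 : 'M[R]_n) (Y : T -> 'M[R]_n) (p : nat) (q : R).
Variable Inv : nat -> set 'M[R]_n.
Hypotheses (mY : measurable_mx Y) (q_ge0 : 0 <= q).
Hypotheses (Inv0 : Inv 0%N A0)
  (InvS : forall j A t, (j < N)%N -> Inv j A -> Inv j.+1 (A + Y t))
  (Inv_ge0 : forall j A, (j <= N)%N -> Inv j A -> 0 <= \tr (A ^+ p)).
Hypothesis step : forall (j : 'I_N) A, Inv j A ->
  (\int[distribution P (x j)]_t (\tr ((A + Y t) ^+ p))%:E <=
   (q * \tr (A ^+ p))%:E)%E.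

Let S (j : nat) (w : W) := A0 + \sum_(i < N | (i < j)%N) Y (x i w).

Let SS (j : 'I_N) w : S j.+1 w = S j w + Y (x j w).
Proof.
rewrite /S -addrA; congr (_ + _); rewrite (bigD1 j) //= addrC; congr (_ + _).
by apply: eq_bigl => i; rewrite ltnS [RHS]ltn_neqAle andbC.
Qed.

Let InvSj j w : (j <= N)%N -> Inv j (S j w).
Proof.
elim: j => [_|j IH jN]; first by rewrite /S big1 ?addr0.
by rewrite (SS (Ordinal jN)); apply: InvS => //; apply: IH; exact: ltnW.
Qed.

(** Both tails are instances, with [Y] the rank-one sample or its opposite. [Inv j] holds surely for
    the partial sum of [j] samples and carries the spectral bounds under which [step] applies. *)
Lemma integral_mxtraceX_le :
  (\int[P]_w (\tr ((A0 + \sum_i Y (x i w)) ^+ p))%:E <=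
   (q ^+ N * \tr (A0 ^+ p))%:E)%E.
Proof.
have mS j : @measurable_mx _ (g_sigma_algebraType (past x j)) R n n (S j).
  apply: measurable_mxD; first exact: measurable_mx_cst.
  apply: measurable_mx_sum => i ij.
  exact: (measurable_mx_comp mY (measurable_from_past (x := x) ij)).
have mSW j : measurable_mx (S j).
  exact: (measurable_mx_comp (mS j) (@measurable_to_past _ _ _ _ _ _ _ x j)).
suff H j : (j <= N)%N ->
    (\int[P]_w (\tr (S j w ^+ p))%:E <= (q ^+ j * \tr (A0 ^+ p))%:E)%E.
  have := H N (leqnn N); congr (integral _ _ _ <= _)%E.
  apply/funext => w; congr (\tr (_ ^+ _))%:E; rewrite /S; congr (_ + _).
  by apply: eq_bigl => i; rewrite ltn_ord.
elim: j => [_|j IH jN].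
  rewrite expr0 mul1r (eq_integral (cst (\tr (A0 ^+ p))%:E)).
    rewrite integral_cst // le_eqVlt; apply/orP; left; apply/eqP.
    by rewrite -[RHS]mule1 -(probability_setT P).
  by move=> w _; rewrite /S big1 ?addr0.
pose j' := Ordinal jN.
pose F (z : g_sigma_algebraType (past x j) * T) :=
  (\tr ((S j z.1 + Y z.2) ^+ p))%:E.
have F0 z : (0 <= F z)%E.
  by rewrite lee_fin (Inv_ge0 (j := j.+1)) //; apply: InvS => //; exact/InvSj/ltnW.
have mF : measurable_fun setT F.
  apply/measurable_EFinP/measurable_mxtrace/measurable_mxX/measurable_mxD.
    exact: (measurable_mx_comp (mS j) measurable_fst).
  exact: (measurable_mx_comp mY measurable_snd).
have -> : (\int[P]_w (\tr (S j.+1 w ^+ p))%:E = \int[P]_w F (w, x j' w))%E.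
  by apply: eq_integral => w _; rewrite (SS j').
rewrite (integral_past indep (j := j')) //.
apply: (@le_trans _ _ (\int[P]_w (q%:E * (\tr (S j w ^+ p))%:E))%E).
  apply: ge0_le_integral => //.
  - by move=> w _; apply: integral_ge0 => t _; exact: F0.
  - exact: (measurable_integral_past (x := x) (j := j')).
  - apply/measurable_EFinP; apply: measurable_funM; first exact: measurable_cst.
    exact/measurable_mxtrace/measurable_mxX.
  - move=> w _; rewrite -EFinM.
    exact: (step (j := j') (InvSj w (ltnW jN))).
rewrite ge0_integralZl_EFin //; last 2 first.
- by move=> w _; rewrite lee_fin (Inv_ge0 (ltnW jN) (InvSj w (ltnW jN))).
- exact/measurable_EFinP/measurable_mxtrace/measurable_mxX.
rewrite exprS -mulrA EFinM; apply: lee_wpmul2l; first by rewrite lee_fin.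
exact/IH/ltnW.
Qed.

End iteration.

(** * Tail bounds *)

Section exponential_bounds.
Context {R : realType}.

Lemma expR_le_quad (h : R) : 0 <= h <= 1 / 2 -> expR h <= 1 + h + h ^+ 2.
Proof.
move=> /andP[h0 h1].
(* The bound 1 / (1 - h) for the exponential already exceeds 1 + h + h^2; its analogue (1 - h /
   3)^(-3) has second-order coefficient 2 / 3, which leaves room. *)
have e3 : expR h = expR (h / 3) ^+ 3 by rewrite -expRM_natl; congr expR; field.
have := expR_ge1Dx (- (h / 3)); rewrite expRN => e1.
have E0 := expR_gt0 (h / 3).
have d0 : 0 < 1 - h / 3 by lra.
have e2 : expR (h / 3) <= (1 - h / 3)^-1.
  by rewrite -[leLHS]invrK lef_pV2 ?posrE ?invr_gt0.
rewrite e3; apply: le_trans (_ : (1 - h / 3)^-1 ^+ 3 <= _).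
  by rewrite lerXn2r // nnegrE ?invr_ge0 ltW.
rewrite exprVn -[leLHS]mul1r ler_pdivrMr ?exprn_gt0 //.
rewrite [leRHS]mulrC; have -> : (1 - h / 3) ^+ 3 * (1 + h + h ^+ 2) =
  1 + h ^+ 2 * (9 - 19 * h + 8 * h ^+ 2 - h ^+ 3) / 27 by field.
rewrite lerDl divr_ge0 // mulr_ge0 ?sqr_ge0 //.
have : h ^+ 3 <= 1 by rewrite exprn_ile1 //; lra.
nra.
Qed.

(** From (1 + u) (1 - u + u^2) = 1 + u^3 >= 1. *)
Lemma expR_le1D (u : R) : 0 <= u -> expR (u - u ^+ 2) <= 1 + u.
Proof.
move=> u0.
have := expR_ge1Dx (- (u - u ^+ 2)); rewrite expRN => e1.
have d0 : 0 < 1 - (u - u ^+ 2) by nra.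
rewrite -[leLHS]invrK -[leRHS]invrK lef_pV2 ?posrE ?invr_gt0 ?expR_gt0 //; last by lra.
apply: le_trans e1; rewrite -[leLHS]mul1r ler_pdivrMr; last by lra.
have : 0 <= u ^+ 3 by rewrite exprn_ge0.
by lra.
Qed.

Lemma expR_le1B (u : R) : 0 <= u <= 1 / 2 -> expR (- (u + 2 * u ^+ 2)) <= 1 - u.
Proof.
move=> /andP[u0 u1].
have := expR_ge1Dx (u + 2 * u ^+ 2); rewrite expRN => e1.
rewrite -[leRHS]invrK lef_pV2 ?posrE ?invr_gt0 ?expR_gt0 //; last by lra.
apply: le_trans e1; rewrite -[leLHS]mul1r ler_pdivrMr; last by lra.
have -> : (1 + (u + 2 * u ^+ 2)) * (1 - u) = 1 + u ^+ 2 * (1 - 2 * u) by ring.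
by rewrite lerDl mulr_ge0 ?sqr_ge0 //; lra.
Qed.

Lemma expr_le_expR (x : R) p : 0 <= 1 + x -> (1 + x) ^+ p <= expR (p%:R * x).
Proof.
by move=> x0; rewrite expRM_natl lerXn2r ?nnegrE ?expR_ge0 // expR_ge1Dx.
Qed.

(** The passage to the limit p = 2 r, along the even exponents for which the trace dominates an
    extreme eigenvalue; [C / p] is the error at exponent p. *)
Lemma le_expR_lim (x y B C : R) (r0 : nat) : 0 <= x -> 0 <= y -> 0 <= C ->
  (forall r, (r0 <= r)%N -> x <= y * expR (B + C / r.*2%:R)) ->
  x <= y * expR B.
Proof.
move=> x0 y0 C0 H; rewrite leNgt; apply/negP => lt_x.
pose del := x - y * expR B; have del0 : 0 < del by rewrite subr_gt0.
(* Being above C gives C / p < 1; being above x C / del gives x C / p < del. *)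
pose r := (r0 + (Num.trunc (C + x * C / del)).+1)%N.
have r_gt : C + x * C / del < r.*2%:R.
  apply: lt_le_trans (truncnS_gt _) _; rewrite ler_nat /r -addnn.
  by apply: leq_trans (leq_addr _ _); exact: leq_addl.
have xC0 : 0 <= x * C / del by rewrite divr_ge0 ?mulr_ge0 // ltW.
have p0 : 0 < r.*2%:R :> R by apply: le_lt_trans r_gt; rewrite addr_ge0.
have Cp : C / r.*2%:R < 1 by rewrite ltr_pdivrMr // mul1r; lra.
have := H r (leq_addr _ _); rewrite expRD mulrA => H1.
have eC : expR (C / r.*2%:R) <= (1 - C / r.*2%:R)^-1.
  have := expR_ge1Dx (- (C / r.*2%:R)); rewrite expRN => e1.
  by rewrite -[leLHS]invrK lef_pV2 ?posrE ?invr_gt0 ?expR_gt0 ?subr_gt0.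
have : x * (1 - C / r.*2%:R) <= y * expR B.
  rewrite -ler_pdivlMr ?subr_gt0 //; apply: le_trans H1 _.
  by rewrite ler_wpM2l // mulr_ge0 ?expR_ge0.
have : x * C / r.*2%:R < del.
  rewrite ltr_pdivrMr // [ltRHS]mulrC -ltr_pdivrMr //.
  by apply: le_lt_trans r_gt; rewrite lerDr.
rewrite mulrBr mulr1 mulrA /del; lra.
Qed.

End exponential_bounds.

Section markov.
Context {d : measure_display} {W : measurableType d} {R : realType}
  (P : probability W R).

Lemma markov_event (E : set W) (g : W -> R) (v b : R) : measurable E ->
  measurable_fun [set: W] g -> (forall w, 0 <= g w) -> 0 <= v ->
  (forall w, E w -> v <= g w) -> (\int[P]_w (g w)%:E <= b%:E)%E ->
  v * fine (P E) <= b.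
Proof.
move=> mE mg g0 v0 vg gb; rewrite -lee_fin EFinM fineK ?fin_num_measure //.
apply: le_trans gb.
have m1 : measurable_fun [set: W] (fun w => (\1_E w : R)%:E).
  exact/measurable_EFinP.
have -> : (v%:E * P E = \int[P]_w (v%:E * (\1_E w : R)%:E))%E.
  by rewrite ge0_integralZl_EFin // integral_indic // setIT.
apply: ge0_le_integral => //.
- by move=> w _; rewrite -EFinM lee_fin mulr_ge0.
- by apply/measurable_EFinP; apply: measurable_funM => //; exact: measurable_cst.
- exact/measurable_EFinP.
- move=> w _; rewrite -EFinM lee_fin indicE.
  by case: (boolP (w \in E)) => [|_]; rewrite ?mulr1 ?mulr0 // inE => /vg.
Qed.

End markov.

Section outer_product_integrals.
Context {d : measure_display} {T : measurableType d} {R : realType}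
  (nu : probability T R) {n : nat} (y : T -> 'cV[R]_n) (a : R) (C : 'M[R]_n).
Let Y t := y t *m (y t)^T.
Hypotheses (mY : measurable_mx Y) (ya : forall t, dot (y t) (y t) <= a).
Hypothesis EY : forall i k, (\int[nu]_t (Y t i k)%:E = (C i k)%:E)%E.

Let Y_le t i k : `|Y t i k| <= a.
Proof.
rewrite /Y mxE big_ord1 mxE.
have sq h : y t h 0 ^+ 2 <= a.
  apply: le_trans (ya t); rewrite dotE (bigD1 h) //= -expr2 lerDl sumr_ge0 //.
  by move=> l _; rewrite -expr2 sqr_ge0.
rewrite ler_norml; have := sq i; have := sq k.
have := sqr_ge0 (y t i 0 + y t k 0); have := sqr_ge0 (y t i 0 - y t k 0).
by nra.
Qed.

Lemma integrable_outer i k : nu.-integrable setT (fun t => (Y t i k)%:E).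
Proof.
apply: measurable_bounded_integrable => //.
- by apply: le_lt_trans (ltry 1); exact: probability_le1.
- exists a; split; first exact: num_real.
  by move=> M aM t _; apply: le_trans (Y_le _ _ _) (ltW aM).
Qed.

Lemma integral_mxtrace_outer (M : 'M[R]_n) c s :
  (\int[nu]_t (c + s * \tr (M *m Y t))%:E = (c + s * \tr (M *m C))%:E)%E.
Proof.
have tr_sum (B : 'M[R]_n) : (\tr (M *m B))%:E =
    (\sum_i \sum_k (M i k)%:E * (B k i)%:E)%E.
  rewrite -sumEFin; apply: eq_bigr => i _; rewrite mxE -sumEFin.
  by apply: eq_bigr => k _; rewrite EFinM.
have intM i k : nu.-integrable setT (fun t => (M i k)%:E * (Y t k i)%:E)%E.
  by apply: integrableZl => //; exact: integrable_outer.
have intS i : nu.-integrable setT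
    (fun t => \sum_k (M i k)%:E * (Y t k i)%:E)%E.
  by apply: integrable_sum.
have intT : nu.-integrable setT (fun t => (\tr (M *m Y t))%:E).
  by under eq_fun do rewrite tr_sum; apply: integrable_sum.
have -> : (fun t => (c + s * \tr (M *m Y t))%:E) =
    (fun t => c%:E + s%:E * (\tr (M *m Y t))%:E)%E.
  by apply/funext => t; rewrite EFinD EFinM.
rewrite integralD //; last 2 first.
- exact: finite_measure_integrable_cst.
- exact: integrableZl.
rewrite integralZl // integral_cst // EFinD EFinM; congr (_ + _ * _)%E.
  by rewrite -[RHS]mule1 -(probability_setT nu).
transitivity (\int[nu]_t (\sum_i \sum_k (M i k)%:E * (Y t k i)%:E))%E.
  by apply: eq_integral => t _; exact: tr_sum.
rewrite integral_sum // tr_sum; apply: eq_bigr => i _.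
rewrite integral_sum //; apply: eq_bigr => k _.
by rewrite integralZl //; [rewrite EY|exact: integrable_outer].
Qed.

End outer_product_integrals.

(** * Tail bounds for a sum of independent rank-one matrices *)

Section trace_moments.
Context {d d' : measure_display} {W : measurableType d} {T : measurableType d'}
  {R : realType} {P : probability W R} {N : nat} (x : 'I_N -> {RV P >-> T}).
Hypothesis indep : independent_RVs x.
Context {n : nat} (y : T -> 'cV[R]_n) (a : R) (D : 'rV[R]_n) (lam : R).
Let Y t := y t *m (y t)^T.
Hypotheses (mY : measurable_mx Y) (a_gt0 : 0 < a) (lam_ge0 : 0 <= lam).
Hypothesis ya : forall t, dot (y t) (y t) <= a.
Hypothesis ED : forall j i k,
  (\int[distribution P (x j)]_t (Y t i k)%:E = (diag_mx D i k)%:E)%E.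

Lemma mxtrace_mul_diag (M : 'M[R]_n) :
  \tr (M *m diag_mx D) = \sum_i D 0 i * M i i.
Proof. by apply: eq_bigr => i _; rewrite mul_mx_diag mxE mulrC. Qed.

Lemma moment_mxtrace (A : 'M[R]_n) p t : moment A (y t) p = \tr (A ^+ p *m Y t).
Proof. by rewrite mxtrace_mul_outer. Qed.

(** The mean of the linear term is tr (A^(p-1) D) <= (lam / K) tr A^p, using A >= K I; a sample thus
    costs a factor 1 + kap lam / K, bounded by its exponential. *)
Lemma upper_trace_bound (K : R) p : 0 < K -> (0 < p)%N ->
  (forall i, D 0 i <= lam) ->
  (\int[P]_w (\tr ((K%:M + \sum_i Y (x i w)) ^+ p))%:E <=
   (expR ((\sum_(i < p) (1 + a / K) ^+ i) * lam / K) ^+ N *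
    (n%:R * K ^+ p))%:E)%E.
Proof.
move=> K0 p0 Dlam; set kap := \sum_(i < p) _.
have kap0 : 0 <= kap.
  by apply: sumr_ge0 => i _; rewrite exprn_ge0 // addr_ge0 // divr_ge0 ?ltW.
have trK : \tr (K%:M ^+ p : 'M[R]_n) = n%:R * K ^+ p.
  by rewrite -rmorphXn /= mxtrace_scalar mulr_natl.
rewrite -trK.
have geY A t : mxge K A -> mxge K (A + Y t).
  move=> [sA gA]; split; first by rewrite linearD /= trmx_mul trmxK sA.
  move=> z; rewrite mulmxDl dotDr; apply: le_trans (gA z) _.
  by rewrite lerDl dot_outer [dot z _]dotC -expr2 sqr_ge0.
apply: (@integral_mxtraceX_le _ _ _ _ _ _ _ _ indep
  _ _ _ _ _ (fun _ A => mxge K A)) => //.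
- split=> [|z]; first by rewrite tr_scalar_mx.
  by rewrite mul_scalar_mx dotZr.
- by move=> j A t _; exact: geY.
- by move=> j A _ gA; exact: (mxtraceX_ge0 K0 gA).
move=> j A gA.
apply: (@le_trans _ _ (\int[distribution P (x j)]_t
    (\tr (A ^+ p) + kap * \tr (A ^+ p.-1 *m Y t))%:E)%E).
  apply: ge0_le_integral => //.
  - by move=> t _; rewrite lee_fin; exact: (mxtraceX_ge0 K0 (geY _ _ gA)).
  - apply/measurable_EFinP/measurable_mxtrace/measurable_mxX/measurable_mxD.
      exact: measurable_mx_cst.
    exact: mY.
  - apply/measurable_EFinP/measurable_funD; first exact: measurable_cst.
    apply: measurable_funM; first exact: measurable_cst.
    by apply: measurable_mxtrace; apply: measurable_mxM;
      [exact: measurable_mx_cst|exact: mY].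
  - by move=> t _; rewrite lee_fin -moment_mxtrace; exact: mxtraceX_rank_one_le.
rewrite (integral_mxtrace_outer mY ya (ED j)) lee_fin.
have trD : \tr (A ^+ p.-1 *m diag_mx D) <= lam / K * \tr (A ^+ p).
  rewrite mxtrace_mul_diag; apply: (@le_trans _ _ (lam * \tr (A ^+ p.-1))).
    rewrite mulr_sumr; apply: ler_sum => i _.
    by rewrite ler_wpM2r // (diag_mxX_ge0 K0).
  rewrite -mulrA ler_wpM2l // ler_pdivlMl //.
  by rewrite -{2}(prednK p0); exact: mxtraceX_geS.
apply: le_trans (_ : (1 + kap * lam / K) * \tr (A ^+ p) <= _).
  by rewrite mulrDl mul1r lerD2l -!mulrA ler_wpM2l // mulrA.
by rewrite ler_wpM2r ?expR_ge1Dx // (mxtraceX_ge0 K0).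
Qed.

(* [N%:R * a < K] keeps every partial difference [K I - ...] positive definite. *)
Lemma lower_trace_bound (K : R) p : N%:R * a < K -> (0 < p)%N ->
  (forall i, lam <= D 0 i) ->
  (\int[P]_w (\tr ((K%:M - \sum_i Y (x i w)) ^+ p))%:E <=
   (expR (- (p%:R * ((1 + a / (K - N%:R * a)) ^+ p.-1)^-1 * lam / K)) ^+ N *
    (n%:R * K ^+ p))%:E)%E.
Proof.
move=> NaK p0 Dlam; set kap := p%:R * _.
pose c := K - N%:R * a.
have c0 : 0 < c by rewrite subr_gt0.
have K0 : 0 < K by apply: le_lt_trans NaK; rewrite mulr_ge0 // ltW.
have kap0 : 0 <= kap.
  rewrite mulr_ge0 // invr_ge0 exprn_ge0 // addr_ge0 // divr_ge0 ?ltW //.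
have trK : \tr (K%:M ^+ p : 'M[R]_n) = n%:R * K ^+ p.
  by rewrite -rmorphXn /= mxtrace_scalar mulr_natl.
rewrite -trK.
(* The lower bound loses [a] with each sample; the upper bound [K] is what allows tr A^(p-1) >= tr
   A^p / K. *)
pose Inv j := [set A : 'M[R]_n | mxge (K - j%:R * a) A /\ mxle A K].
have InvS j A t : Inv j A -> Inv j.+1 (A - Y t).
  move=> [[sA gA] lA]; split; first split.
  - by rewrite linearB /= trmx_mul trmxK sA.
  - move=> z; rewrite mulmxBl dotBr dot_outer [dot (y t) z]dotC -expr2.
    have -> : K - j.+1%:R * a = K - j%:R * a - a by rewrite -natr1; ring.
    rewrite mulrBl lerB //.
    apply: le_trans (CauchySchwarz _ _) _.
    by rewrite mulrC ler_wpM2r ?dot_ge0.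
  - move=> z; rewrite mulmxBl dotBr dot_outer [dot (y t) z]dotC -expr2.
    by rewrite lerBlDr; apply: le_trans (lA z) _; rewrite lerDl sqr_ge0.
have Invc j A : (j <= N)%N -> Inv j A -> mxge c A.
  move=> jN [gA _]; apply: mxgeW gA.
  by rewrite lerD2l lerN2 ler_wpM2r ?ler_nat // ltW.
have -> : (fun w => (\tr ((K%:M - \sum_i Y (x i w)) ^+ p))%:E) =
    (fun w => (\tr ((K%:M + \sum_i - Y (x i w)) ^+ p))%:E).
  by apply/funext => w; rewrite sumrN.
have mNY : measurable_mx (fun t => - Y t).
  rewrite (_ : (fun t => _) = fun t => -1 *: Y t); first exact: measurable_mxZ.
  by apply/funext => t; rewrite scaleN1r.
apply: (@integral_mxtraceX_le _ _ _ _ _ _ _ _ indep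
  _ _ (fun t => - Y t) _ _ Inv) => //.
- split; last by move=> z; rewrite mul_scalar_mx dotZr.
  split=> [|z]; first by rewrite tr_scalar_mx.
  by rewrite mul_scalar_mx dotZr mul0r subr0.
- by move=> j A t _; exact: InvS.
- by move=> j A jN /(Invc _ _ jN) gA; exact: (mxtraceX_ge0 c0 gA).
move=> j A IA.
have gA : mxge c A by apply: Invc IA; exact: ltnW.
have gAY t : mxge c (A - Y t) by apply: (Invc j.+1) (InvS _ _ _ IA).
apply: (@le_trans _ _ (\int[distribution P (x j)]_t
    (\tr (A ^+ p) + (- kap) * \tr (A ^+ p.-1 *m Y t))%:E)%E).
  apply: ge0_le_integral => //.
  - by move=> t _; rewrite lee_fin; exact: (mxtraceX_ge0 c0 (gAY t)).
  - apply/measurable_EFinP/measurable_mxtrace/measurable_mxX/measurable_mxD.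
      exact: measurable_mx_cst.
    exact: mNY.
  - apply/measurable_EFinP/measurable_funD; first exact: measurable_cst.
    apply: measurable_funM; first exact: measurable_cst.
    by apply: measurable_mxtrace; apply: measurable_mxM;
      [exact: measurable_mx_cst|exact: mY].
  - move=> t _; rewrite lee_fin -moment_mxtrace mulNr lerBrDr.
    (* The smaller matrix is [A - Y t], so the moment in the bound is that of [A], which is
       independent of the new sample. *)
    have := mxtraceX_rank_one_ge c0 (gAY t) (ya t) p.
    by rewrite subrK.
rewrite (integral_mxtrace_outer mY ya (ED j)) lee_fin mulNr.
have trD : lam / K * \tr (A ^+ p) <= \tr (A ^+ p.-1 *m diag_mx D).
  rewrite mxtrace_mul_diag; apply: (@le_trans _ _ (lam * \tr (A ^+ p.-1))).
    rewrite -mulrA ler_wpM2l // ler_pdivrMl //.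
    rewrite -{1}(prednK p0); apply: mxtraceX_leS c0 gA _ _ (ltW K0) _.
    by case: IA.
  rewrite mulr_sumr; apply: ler_sum => i _.
  by rewrite ler_wpM2r // (diag_mxX_ge0 c0).
apply: le_trans (_ : (1 - kap * lam / K) * \tr (A ^+ p) <= _).
  rewrite mulrBl mul1r lerD2l lerN2.
  have -> : kap * lam / K * \tr (A ^+ p) = kap * (lam / K * \tr (A ^+ p)).
    by rewrite !mulrA.
  exact: ler_wpM2l.
by rewrite ler_wpM2r ?expR_ge1Dx // (mxtraceX_ge0 c0).
Qed.

Let SY w := \sum_i Y (x i w).

Let measurable_SY : measurable_mx SY.
Proof.
apply: measurable_mx_sum => i _.
exact: (measurable_mx_comp mY (measurable_funP (x i))).
Qed.

Let trmx_SY w : (SY w)^T = SY w.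
Proof.
by rewrite /SY linear_sum; apply: eq_bigr => i _; rewrite /= trmx_mul trmxK.
Qed.

Let dot_SY w z : dot z (SY w *m z) = \sum_i dot (y (x i w)) z ^+ 2.
Proof.
rewrite /SY mulmx_suml /dot mulmx_sumr summxE; apply: eq_bigr => i _.
by rewrite -[LHS]/(dot z (Y (x i w) *m z)) /Y dot_outer [dot z _]dotC -expr2.
Qed.

(* [K = p a / h] makes [(I + S / K)^p] approximate [exp (h S / a)]. *)
Lemma upper_tail (h : R) (E : set W) : measurable E -> 0 < h <= 1 / 2 ->
  (forall i, D 0 i <= lam) ->
  (forall w, E w -> exists2 z : 'cV[R]_n, z != 0 &
    N%:R * ((1 + 2 * h) * lam) * dot z z <= dot z (SY w *m z)) ->
  fine (P E) <= n%:R * expR (- (N%:R * lam * h ^+ 2 / a)).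
Proof.
move=> mE /andP[h0 h1] Dlam Ez; pose s := N%:R * ((1 + 2 * h) * lam).
have s0 : 0 <= s by rewrite /s !mulr_ge0 //; lra.
(* The error is p u^2 with u = s / K = s h / (p a), from 1 + u >= exp (u - u^2). *)
apply: (@le_expR_lim R _ _ _ (s ^+ 2 * h ^+ 2 / a ^+ 2) 1).
- exact: fine_ge0.
- exact: ler0n.
- by apply: divr_ge0; [apply: mulr_ge0|]; exact: sqr_ge0.
move=> r r0; set p := r.*2.
have p0 : (0 < p)%N by rewrite double_gt0.
have pR0 : 0 < p%:R :> R by rewrite ltr0n.
pose K := p%:R * a / h.
have K0 : 0 < K by rewrite divr_gt0 // mulr_gt0.
have gK w : mxge K (K%:M + SY w).
  split=> [|z]; first by rewrite linearD /= tr_scalar_mx trmx_SY.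
  rewrite mulmxDl dotDr mul_scalar_mx dotZr lerDl dot_SY.
  by apply: sumr_ge0 => i _; exact: sqr_ge0.
have mg : measurable_fun [set: W] (fun w => \tr ((K%:M + SY w) ^+ p)).
  apply/measurable_mxtrace/measurable_mxX/measurable_mxD.
    exact: measurable_mx_cst.
  exact: measurable_SY.
have := upper_trace_bound K0 p0 Dlam.
set kap := \sum_(i < p) _ => bnd.
have g0 w : 0 <= \tr ((K%:M + SY w) ^+ p) by exact: (mxtraceX_ge0 K0 (gK w)).
have v0 : 0 <= (K + s) ^+ p by rewrite exprn_ge0 // addr_ge0 // ltW.
have vE w : E w -> (K + s) ^+ p <= \tr ((K%:M + SY w) ^+ p).
  move=> /Ez[z z0 sz]; apply: (expr_le_mxtraceX _ K0 (gK w) _ z0).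
    by rewrite addr_ge0 // ltW.
  by rewrite mulmxDl dotDr mul_scalar_mx dotZr mulrDl lerD2l.
have := markov_event mE mg g0 v0 vE bnd.
set PE := fine (P E).
have PE0 : 0 <= PE by exact: fine_ge0.
pose u := s / K.
have u0 : 0 <= u by rewrite divr_ge0 // ltW.
have -> : K + s = K * (1 + u) by rewrite /u; field; rewrite gt_eqF.
rewrite exprMn mulrA [leRHS]mulrC -!(mulrA (K ^+ p)) ler_pM2l ?exprn_gt0 //.
rewrite -expRM_natl [n%:R * _]mulrC => H.
(* The geometric sum gives kap a / K = (1 + a / K)^p - 1 <= exp h - 1, since p a / K = h. *)
have kapE : kap * lam / K <= lam * (h + h ^+ 2) / a.
  have kapK : kap * (a / K) <= h + h ^+ 2.
    have -> : kap * (a / K) = (1 + a / K) ^+ p - 1.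
      by rewrite subrX1 addrC addKr mulrC.
    have := @expr_le_expR R (a / K) p; have -> : p%:R * (a / K) = h.
      by rewrite /K; field; rewrite !gt_eqF.
    have := @expR_le_quad R h; rewrite (ltW h0) h1 => /(_ isT) e1 /(_ _) e2.
    rewrite lerBlDl; apply: le_trans (e2 _) _; last by rewrite addrA.
    by rewrite addr_ge0 // divr_ge0 ?ltW.
  rewrite ler_pdivlMr //.
  have -> : kap * lam / K * a = lam * (kap * (a / K)) by ring.
  by rewrite ler_wpM2l.
have upow : expR (p%:R * (u - u ^+ 2)) <= (1 + u) ^+ p.
  by rewrite expRM_natl lerXn2r ?nnegrE ?expR_ge0 ?addr_ge0 // expR_le1D.
have H2 : expR (p%:R * (u - u ^+ 2)) * PE <= expR (N%:R * (kap * lam / K)) * n%:R.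
  exact: le_trans (ler_wpM2r PE0 upow) H.
rewrite -(ler_pM2l (expR_gt0 (p%:R * (u - u ^+ 2)))).
apply: le_trans H2 _; rewrite [leLHS]mulrC [leRHS]mulrA [leRHS]mulrC.
rewrite ler_wpM2l // -expRD ler_expR.
have -> : p%:R * (u - u ^+ 2) = s * h / a - s ^+ 2 * h ^+ 2 / a ^+ 2 / p%:R.
  by rewrite /u /K; field; rewrite !gt_eqF.
(* The 1 / p errors cancel, and (1 + 2 h) h - h^2 = h + h^2 matches the growth bound exactly. *)
have -> : s * h / a - s ^+ 2 * h ^+ 2 / a ^+ 2 / p%:R +
    (- (N%:R * lam * h ^+ 2 / a) + s ^+ 2 * h ^+ 2 / a ^+ 2 / p%:R) =
    N%:R * (lam * (h + h ^+ 2) / a).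
  by rewrite /s; field; rewrite !gt_eqF.
by rewrite ler_wpM2l.
Qed.

Lemma lower_tail (h : R) (E : set W) : measurable E -> 0 < h <= 1 / 2 ->
  (forall i, lam <= D 0 i) ->
  (forall w, E w -> exists2 z : 'cV[R]_n, z != 0 &
    dot z (SY w *m z) <= N%:R * ((1 - 2 * h) * lam) * dot z z) ->
  fine (P E) <= n%:R * expR (- (N%:R * lam * h ^+ 2 / a)).
Proof.
move=> mE /andP[h0 h1] Dlam Ez; pose s := N%:R * ((1 - 2 * h) * lam).
have s0 : 0 <= s by rewrite /s !mulr_ge0 //; lra.
(* Two errors of order 1 / p: the first from having c = K - N a in place of K in the update factor,
   the second from 1 - u >= exp (- (u + 2 u^2)). *)
pose C := 2 * N%:R ^+ 2 * lam * h ^+ 3 / a + 2 * s ^+ 2 * h ^+ 2 / a ^+ 2.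
apply: (@le_expR_lim R _ _ _ C (Num.trunc (N%:R * h + s * h / a)).+1).
- exact: fine_ge0.
- exact: ler0n.
- have h0' := ltW h0; have a0' := ltW a_gt0.
  rewrite /C; apply: addr_ge0; apply: divr_ge0; rewrite ?exprn_ge0 //.
    by rewrite !mulr_ge0 ?exprn_ge0.
  by apply: mulr_ge0 (sqr_ge0 h); apply: mulr_ge0 (sqr_ge0 s).
move=> r r0; set p := r.*2.
have r_gt : N%:R * h + s * h / a < r%:R.
  by apply: lt_le_trans (truncnS_gt _) _; rewrite ler_nat.
have p0 : (0 < p)%N by rewrite double_gt0; exact: leq_ltn_trans r0.
have pR0 : 0 < p%:R :> R by rewrite ltr0n.
have pE : p%:R = 2 * r%:R :> R by rewrite /p -muln2 natrM mulrC.
pose K := p%:R * a / h.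
have K0 : 0 < K by rewrite divr_gt0 // mulr_gt0.
(* This fixes the least admissible r; it yields both u <= 1 / 2 and c >= K / 2. *)
have K_ge : 2 * (N%:R * a) + 2 * s <= K.
  rewrite /K ler_pdivlMr // pE.
  have -> : (2 * (N%:R * a) + 2 * s) * h = 2 * (N%:R * h + s * h / a) * a.
    by field; rewrite gt_eqF.
  by rewrite ler_wpM2r ?(ltW a_gt0) // ler_wpM2l // ltW.
have Na0 : 0 <= N%:R * a by rewrite mulr_ge0 // ltW.
have NaK : N%:R * a < K by lra.
pose c := K - N%:R * a.
have c0 : 0 < c by rewrite subr_gt0.
have gc w : mxge c (K%:M - SY w).
  split=> [|z]; first by rewrite linearB /= tr_scalar_mx trmx_SY.
  rewrite mulmxBl dotBr mul_scalar_mx dotZr /c mulrBl lerD2l lerN2 dot_SY.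
  rewrite -mulrA mulr_natl -[X in _ *+ X](card_ord N) -sumr_const.
  apply: ler_sum => i _; apply: le_trans (CauchySchwarz _ _) _.
  by rewrite ler_wpM2r ?dot_ge0.
have mg : measurable_fun [set: W] (fun w => \tr ((K%:M - SY w) ^+ p)).
  apply/measurable_mxtrace/measurable_mxX.
  rewrite (_ : (fun w => _) = fun w => K%:M + -1 *: SY w).
    apply: measurable_mxD; first exact: measurable_mx_cst.
    exact: measurable_mxZ.
  by apply/funext => w; rewrite scaleN1r.
have := lower_trace_bound NaK p0 Dlam.
rewrite -/c; set kap := p%:R * _ => bnd.
have g0 w : 0 <= \tr ((K%:M - SY w) ^+ p) by exact: (mxtraceX_ge0 c0 (gc w)).
have Ks0 : 0 <= K - s by lra.
have v0 : 0 <= (K - s) ^+ p by rewrite exprn_ge0.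
have vE w : E w -> (K - s) ^+ p <= \tr ((K%:M - SY w) ^+ p).
  move=> /Ez[z z0 sz]; apply: (expr_le_mxtraceX _ c0 (gc w) Ks0 z0).
  by rewrite mulmxBl dotBr mul_scalar_mx dotZr mulrBl lerD2l lerN2.
have := markov_event mE mg g0 v0 vE bnd.
set PE := fine (P E).
have PE0 : 0 <= PE by exact: fine_ge0.
pose u := s / K.
have u0 : 0 <= u by rewrite divr_ge0 // ltW.
have u1 : u <= 1 / 2 by rewrite ler_pdivrMr //; lra.
have -> : K - s = K * (1 - u) by rewrite /u; field; rewrite gt_eqF.
rewrite exprMn mulrA [leRHS]mulrC -!(mulrA (K ^+ p)) ler_pM2l ?exprn_gt0 //.
rewrite -expRM_natl [n%:R * _]mulrC => H.
have kapE : lam * (h / a) * (1 - h - 2 * h ^+ 2 * N%:R / p%:R) <= kap * lam / K.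
  have -> : kap * lam / K = lam * (h / a) * ((1 + a / c) ^+ p.-1)^-1.
    rewrite /kap /K; field.
    by rewrite !gt_eqF // exprn_gt0 // ltr_pwDl // divr_ge0 // ltW.
  have ac0 : 0 <= a / c by rewrite divr_ge0 // ltW.
  have rho0 : 0 < 1 + a / c by rewrite ltr_pwDl.
  rewrite ler_wpM2l //; first by rewrite mulr_ge0 // divr_ge0 // ltW.
  have e1 : (1 + a / c) ^+ p.-1 <= expR (p%:R * (a / c)).
    apply: le_trans (expr_le_expR p (ltW rho0)).
    by rewrite ler_weXn2l ?lerDl // leq_pred.
  have e2 : expR (- (p%:R * (a / c))) <= ((1 + a / c) ^+ p.-1)^-1.
    by rewrite expRN lef_pV2 ?posrE ?expR_gt0 ?exprn_gt0.
  apply: le_trans e2; apply: le_trans (expR_ge1Dx _).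
  have -> : p%:R * (a / c) = h + h * (N%:R * a) / c.
    have -> : p%:R * (a / c) = h * K / c.
      by rewrite /K; field; rewrite !gt_eqF.
    have -> : K = c + N%:R * a by rewrite /c subrK.
    by field; rewrite gt_eqF.
  have : h * (N%:R * a) / c <= 2 * h ^+ 2 * N%:R / p%:R.
    have -> : 2 * h ^+ 2 * N%:R / p%:R = h * (N%:R * a) * (K / 2)^-1.
      by rewrite /K; field; rewrite !gt_eqF.
    rewrite ler_wpM2l ?mulr_ge0 ?(ltW h0) ?(ltW a_gt0) //.
    have K2 : 0 < K / 2 by lra.
    by rewrite lef_pV2 ?posrE // /c; lra.
  by lra.
have upow : expR (- (p%:R * (u + 2 * u ^+ 2))) <= (1 - u) ^+ p.
  rewrite -mulrN expRM_natl lerXn2r ?nnegrE ?expR_ge0 //; first by lra.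
  by apply: expR_le1B; rewrite u0.
have H2 : expR (- (p%:R * (u + 2 * u ^+ 2))) * PE <=
    expR (N%:R * - (kap * lam / K)) * n%:R.
  exact: le_trans (ler_wpM2r PE0 upow) H.
rewrite -(ler_pM2l (expR_gt0 (- (p%:R * (u + 2 * u ^+ 2))))).
apply: le_trans H2 _; rewrite [leLHS]mulrC [leRHS]mulrA [leRHS]mulrC.
rewrite ler_wpM2l // -expRD ler_expR.
have -> : p%:R * (u + 2 * u ^+ 2) =
    s * h / a + 2 * s ^+ 2 * h ^+ 2 / a ^+ 2 / p%:R.
  by rewrite /u /K; field; rewrite !gt_eqF.
have -> : - (s * h / a + 2 * s ^+ 2 * h ^+ 2 / a ^+ 2 / p%:R) +
    (- (N%:R * lam * h ^+ 2 / a) + C / p%:R) =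
    - (N%:R * (lam * (h / a) * (1 - h - 2 * h ^+ 2 * N%:R / p%:R))).
  by rewrite /C /s; field; rewrite !gt_eqF.
by rewrite mulrN lerN2 ler_wpM2l.
Qed.

End trace_moments.

(** * Eigenvalues of the sample covariance *)

Section measurable_eigenvalues.
Context {R : realType}.

Lemma Bernoulli_le (z : R) p : 0 <= z -> 1 + p%:R * z <= (1 + z) ^+ p.
Proof.
move=> z0; elim: p => [|p IH]; first by rewrite mul0r addr0 expr0.
rewrite exprS; apply: le_trans (_ : (1 + z) * (1 + p%:R * z) <= _).
  have : 0 <= p%:R * z * z by rewrite !mulr_ge0.
  by rewrite -natr1; nra.
by rewrite ler_wpM2l // addr_ge0.
Qed.

(* The largest of finitely many nonnegative reals is read off their power
   sums. *)
Lemma le_power_sums (l : nat -> R) (k m : nat) (t : R) : (1 <= k <= m)%N ->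
  (forall i j, (k <= i)%N -> (i <= j)%N -> (j <= m)%N -> l j <= l i) ->
  (forall i, (k <= i <= m)%N -> 0 <= l i) -> 0 <= t ->
  l k <= t <-> forall p, \sum_(k <= i < m.+1) l i ^+ p <= m%:R * t ^+ p.
Proof.
move=> /andP[k1 km] desc l0 t0; split=> [lkt p|H].
  apply: le_trans (_ : \sum_(k <= i < m.+1) t ^+ p <= _).
    rewrite !big_nat; apply: ler_sum => i /andP[ki im].
    have li0 : 0 <= l i by rewrite l0 // ki -ltnS.
    by rewrite lerXn2r ?nnegrE // (le_trans _ lkt) // desc // -ltnS.
  rewrite big_const_nat iter_addr_0 -[_ *+ (_ - _)]mulr_natl ler_wpM2r ?exprn_ge0 //.
  by rewrite ler_nat leq_subLR -add1n leq_add.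
have lk p : l k ^+ p <= m%:R * t ^+ p.
  apply: le_trans (H p); rewrite big_nat_recl //  lerDl.
  rewrite big_nat; apply: sumr_ge0 => i /andP[ki im]; rewrite exprn_ge0 // l0 //.
  by rewrite im (leq_trans ki).
rewrite leNgt; apply/negP => tlk.
have := t0; rewrite le_eqVlt => /predU1P[t00|tgt0].
  by have := lk 1%N; rewrite !expr1 -t00 mulr0 t00 leNgt tlk.
pose z := l k / t - 1.
have z0 : 0 < z by rewrite subr_gt0 ltr_pdivlMr // mul1r.
pose p := (Num.trunc (m%:R / z)).+1.
have zE : 1 + z = l k / t by rewrite /z addrC subrK.
have := Bernoulli_le p (ltW z0); rewrite zE => H1.
have : (l k / t) ^+ p <= m%:R by rewrite expr_div_n ler_pdivrMr ?exprn_gt0.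
move=> /(le_trans H1).
have : m%:R < p%:R * z by rewrite -ltr_pdivrMr // truncnS_gt.
by lra.
Qed.

(* A measure is a total function whose value is arbitrary off the measurable
   sets, so the events about eigenvalues have to be shown measurable. *)
Lemma measurable_eigenvalue d (W : measurableType d) (m : nat)
    (A : W -> 'M[R]_m) (l : W -> nat -> R) (k : nat) :
  measurable_mx A -> (forall w, mxge 0 (A w)) ->
  (forall w, eigenvalues_desc (A w) (l w)) -> (1 <= k <= m)%N ->
  measurable_fun [set: W] (fun w => l w k).
Proof.
move=> mA A0 eigA.
have l0 w i : (1 <= i <= m)%N -> 0 <= l w i.
  by move=> im; apply: (eigenvalue_ge0 (proj1 (A0 w)) (eigA w)).
elim/ltn_ind: k => k IH /andP[k1 km].
(* By induction the larger eigenvalues are measurable, hence so are the power sums of the remaining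
   ones, of which [l w k] is the largest. *)
pose S p w := \tr (A w ^+ p) - \sum_(1 <= i < k) l w i ^+ p.
have SE p w : S p w = \sum_(k <= i < m.+1) l w i ^+ p.
  rewrite /S (mxtraceX_eigenvalues (proj1 (A0 w)) (eigA w)).
  by rewrite (@big_cat_nat _ _ _ k) //= ?(leq_trans km) // addrC addrK.
have mS p : measurable_fun [set: W] (S p).
  apply: measurable_funB; first exact/measurable_mxtrace/measurable_mxX.
  rewrite (_ : (fun w => _) = fun w => \sum_(i < k.-1) l w i.+1 ^+ p).
    apply: measurable_sum => i; apply: measurable_funX; apply: IH.
      by rewrite -[X in (_ < X)%N](prednK k1) ltnS.
    by rewrite /= (leq_trans _ km) // -[X in (_ <= X)%N](prednK k1) ltnW // ltnS.
  by apply/funext => w; rewrite big_add1 big_mkord.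
apply: (measurability (@RGenOInfty.G R)) => [|/= _ [_] [t] -> <-].
  exact: RGenOInfty.measurableE.
rewrite setTI.
have -> : (fun w => l w k) @^-1` `]t, +oo[%classic = ~` [set w | l w k <= t].
  by apply/seteqP; split => w /=; rewrite in_itv /= andbT ltNge; move/negP.
apply: measurableC; have [t0|t0] := leP 0 t; last first.
  rewrite (_ : mkset _ = set0) //; apply/seteqP; split => w //= lt.
  by have := l0 w k; rewrite k1 km leNgt (le_lt_trans lt t0) => /(_ isT).
rewrite (_ : mkset _ = \bigcap_p [set w | S p w <= m%:R * t ^+ p]).
  apply: bigcapT_measurable => p; rewrite -[mkset _]setTI.
  by apply: measurable_fun_le => //; exact: measurable_cst.
have key w : l w k <= t <-> forall p, S p w <= m%:R * t ^+ p.
  have l0k i : (k <= i <= m)%N -> 0 <= l w i.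
    by move=> /andP[ki im]; rewrite l0 // im (leq_trans k1 ki).
  have desc i j : (k <= i)%N -> (i <= j)%N -> (j <= m)%N -> l w j <= l w i.
    by move=> ki; apply: (proj2 (eigA w)); exact: leq_trans ki.
  rewrite (le_power_sums (introT andP (conj k1 km)) desc l0k t0).
  by split=> K p; have := K p; rewrite SE.
apply/seteqP; split => w /=; first by move/key => K p _; exact: K.
by move=> K; apply/key => p; exact: K.
Qed.

End measurable_eigenvalues.

Section sample_covariance.
Context {d d' : measure_display} {W : measurableType d} {T : measurableType d'}
  {R : realType} {P : probability W R} {N : nat} (x : 'I_N -> {RV P >-> T}).
Hypotheses (indep : independent_RVs x) (N_gt0 : (0 < N)%N).
Context {m : nat} (g : T -> 'cV[R]_m) (a : R) (C : 'M[R]_m) (l : nat -> R)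
  (lh : W -> nat -> R).
Let G t := g t *m (g t)^T.
Let Chat w := N%:R^-1 *: \sum_j G (x j w).
Hypotheses (mG : measurable_mx G) (ga : forall t, dot (g t) (g t) <= a).
Hypothesis EG : forall j i k,
  (\int[distribution P (x j)]_t (G t i k)%:E = (C i k)%:E)%E.
Hypotheses (symC : C^T = C) (eigC : eigenvalues_desc C l)
  (eigChat : forall w, eigenvalues_desc (Chat w) (lh w)).

Let psd_Chat w : mxge 0 (Chat w).
Proof.
split=> [|z].
  rewrite /Chat linearZ linear_sum /=; congr (_ *: _).
  by apply: eq_bigr => i _; rewrite trmx_mul trmxK.
rewrite mul0r /Chat -scalemxAl dotZr mulr_ge0 ?invr_ge0 //.
rewrite mulmx_suml /dot mulmx_sumr summxE; apply: sumr_ge0 => i _.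
by rewrite -/(dot z (G (x i w) *m z)) dot_outer [dot z _]dotC -expr2 sqr_ge0.
Qed.

Lemma measurable_sample_eigenvalue k : (1 <= k <= m)%N ->
  measurable_fun [set: W] (fun w => lh w k).
Proof.
move=> km; apply: (measurable_eigenvalue _ psd_Chat eigChat km).
apply: measurable_mxZ; apply: measurable_mx_sum => i _.
exact: (measurable_mx_comp mG (measurable_funP (x i))).
Qed.

Section compression.
Context {r : nat} (V : 'M[R]_(m, r)) (D : 'rV[R]_r).
Hypotheses (VV : V^T *m V = 1%:M) (VCV : V^T *m C *m V = diag_mx D).
Let y t := V^T *m g t.

Let YE t : y t *m (y t)^T = V^T *m G t *m V.
Proof. by rewrite /y /G trmx_mul trmxK !mulmxA. Qed.

(** Cauchy-Schwarz for [g t] and [V *m y t], where [V *m y t] is as long as [y t] because [V] is an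
    isometry. *)
Lemma compressed_norm_le t : dot (y t) (y t) <= a.
Proof.
apply: le_trans (ga t).
have [->|y0] := eqVneq (dot (y t) (y t)) 0; first exact: dot_ge0.
have y_gt0 : 0 < dot (y t) (y t) by rewrite lt_neqAle eq_sym y0 dot_ge0.
rewrite -(ler_pM2r y_gt0) -expr2.
have {1}-> : dot (y t) (y t) = dot (g t) (V *m y t).
  by rewrite {1}/y dot_mulmxl trmxK.
apply: le_trans (CauchySchwarz _ _) _.
by rewrite dot_mulmxl mulmxA VV mul1mx.
Qed.

Lemma compressed_measurable : measurable_mx (fun t => y t *m (y t)^T).
Proof.
rewrite (_ : (fun t => _) = fun t => V^T *m G t *m V).
  apply: measurable_mxM; last exact: measurable_mx_cst.
  by apply: measurable_mxM => //; exact: measurable_mx_cst.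
by apply/funext => t; exact: YE.
Qed.

Lemma compressed_mean j i k :
  (\int[distribution P (x j)]_t ((y t *m (y t)^T) i k)%:E =
   (diag_mx D i k)%:E)%E.
Proof.
(* The entry [(i, k)] of a compression is a trace against this [M], so the known integral of a trace
   applies. *)
pose M := V *m delta_mx k i *m V^T.
have trM (B : 'M[R]_m) : \tr (M *m B) = (V^T *m B *m V) i k.
  rewrite /M -!mulmxA mxtrace_mulC -mulmxA.
  rewrite /mxtrace (bigD1 k) //= big1 => [|h hk].
    rewrite addr0 mxE (bigD1 i) //= big1 => [|h hi].
      by rewrite mxE !eqxx mul1r addr0 mulmxA.
    by rewrite mxE (negbTE hi) andbF mul0r.
  by rewrite mxE big1 // => e _; rewrite mxE (negbTE hk) mul0r.
have := integral_mxtrace_outer mG ga (EG j) M 0 1.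
rewrite add0r mul1r trM VCV => <-; apply: eq_integral => t _.
by rewrite add0r mul1r trM YE.
Qed.

Lemma compressed_sample w z : dot z (V^T *m Chat w *m V *m z) =
  N%:R^-1 * dot z ((\sum_j y (x j w) *m (y (x j w))^T) *m z).
Proof.
rewrite /Chat -!(scalemxAl, scalemxAr) dotZr; congr (_ * dot _ (_ *m _)).
by rewrite mulmx_sumr mulmx_suml; apply: eq_bigr => i _; rewrite YE.
Qed.

End compression.

Hypothesis a_gt0 : 0 < a.

(** Compressing to one eigenvector shows [l k] as the mean of a square; [N_gt0] provides a sample
    whose law is used. *)
Lemma eigenvalue_mean_ge0 k : (1 <= k <= m)%N -> 0 <= l k.
Proof.
move=> /andP[k1 km].
have km' : (k.-1 < m)%N by rewrite prednK.
have [|V VV VCV] := @orthonormal_eigenvectors R m C l symC eigC 1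
  (fun=> Ordinal km') _; first by move=> i j _; rewrite !ord1.
have := compressed_mean VCV (Ordinal N_gt0) 0 0.
rewrite !mxE eqxx mulr1n /= prednK // => E.
rewrite -lee_fin -E; apply: integral_ge0 => t _.
by rewrite lee_fin mxE big_ord1 [X in _ * X]mxE -expr2 sqr_ge0.
Qed.


(** m - k + 1 is the least dimension for which [Courant_Fischer_ge] applies. It becomes the
    prefactor as the trace of the identity on the compressed space. The tail bound is taken at h =
    eps / 2. *)
Lemma sample_eigenvalue_upper_tail k eps : (1 <= k <= m)%N -> 0 < eps <= 1 ->
  fine (P [set w | (1 + eps) * l k <= lh w k]) <=
    (m - k + 1)%N%:R * expR (- (N%:R * l k * (eps / 2) ^+ 2 / a)).
Proof.
move=> km /andP[eps0 eps1]; have /andP[k1 km'] := km.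
have fP (j : 'I_(m - k + 1)) : (k.-1 + j < m)%N.
  have jm : (j <= m - k)%N by rewrite -ltnS -[X in (_ < X)%N]addn1 ltn_ord.
  apply: (@leq_ltn_trans (k.-1 + (m - k))); first by rewrite leq_add2l.
  by rewrite -[X in (_ < X)%N](subnKC km') ltn_add2r prednK.
pose f j := Ordinal (fP j).
have injf : injective f by move=> i j /(congr1 val)/addnI/val_inj.
have [V VV VCV] := @orthonormal_eigenvectors R m C l symC eigC _ f injf.
have lk0 := eigenvalue_mean_ge0 km.
apply: (upper_tail (y := fun t => V^T *m g t) indep (compressed_measurable V)
  a_gt0 lk0 (compressed_norm_le VV) (compressed_mean VCV)).
- rewrite -[X in measurable X]setTI; apply: measurable_fun_le => //.
  exact: measurable_sample_eigenvalue.
- by apply/andP; split; lra.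
- move=> i; rewrite mxE; apply: (proj2 eigC) => //=.
    by rewrite -addSn prednK // leq_addr.
- move=> w /= lw.
  have [|z z0] := Courant_Fischer_ge (proj1 (psd_Chat w)) (eigChat w) VV km.
    by rewrite addn1.
  rewrite compressed_sample // => H; exists z => //.
  rewrite -mulrA -ler_pdivlMl ?ltr0n //; apply: le_trans H.
  rewrite ler_wpM2r ?dot_ge0 //; apply: le_trans lw.
  by have -> : 2 * (eps / 2) = eps by field.
Qed.

Lemma sample_eigenvalue_lower_tail k eps : (1 <= k <= m)%N -> 0 < eps <= 1 ->
  fine (P [set w | lh w k <= (1 - eps) * l k]) <=
    k%:R * expR (- (N%:R * l k * (eps / 2) ^+ 2 / a)).
Proof.
move=> km /andP[eps0 eps1]; have /andP[k1 km'] := km.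
pose f := widen_ord km'.
have injf : injective f by move=> i j /(congr1 val) ij; exact: val_inj.
have [V VV VCV] := @orthonormal_eigenvectors R m C l symC eigC _ f injf.
have lk0 := eigenvalue_mean_ge0 km.
apply: (lower_tail (y := fun t => V^T *m g t) indep (compressed_measurable V)
  a_gt0 lk0 (compressed_norm_le VV) (compressed_mean VCV)).
- rewrite -[X in measurable X]setTI; apply: measurable_fun_le => //.
  exact: measurable_sample_eigenvalue.
- by apply/andP; split; lra.
- by move=> i; rewrite mxE; apply: (proj2 eigC) => //=; exact: ltn_ord.
- move=> w /= lw.
  have [z z0] := Courant_Fischer_le (proj1 (psd_Chat w)) (eigChat w) VV km (leqnn k).
  rewrite compressed_sample // => H; exists z => //.
  rewrite -mulrA -ler_pdivrMl ?ltr0n //; apply: le_trans H _.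
  rewrite ler_wpM2r ?dot_ge0 //; apply: le_trans lw _.
  by have -> : 2 * (eps / 2) = eps by field.
Qed.

End sample_covariance.

Theorem theorem3p1
  (R : realType) (m : nat) (hm : (1 < m)%N)
  (X : set 'cV[R]_m) (hX : centered_same_range X)
  (rho : 'cV[R]_m -> R) (hrho : is_density rho)
  (hbounded : exists M : R, forall x, rho x <= M)
  (hseparable : separable_fun rho)
  (hpos : forall x, X x -> 0 < rho x)
  (hzero : forall x, ~ X x -> rho x = 0)
  (f : 'cV[R]_m -> R) (gradf : 'cV[R]_m -> 'cV[R]_m)
  (hgrad : is_gradient_on X f gradf)
  (hac : abs_continuous_on X f)
  (hmeas : forall i j, measurable_fun X (fun x => outer (gradf x) i j))
  (L : R) (hL : forall x, X x -> norm2 (gradf x) <= L)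
  (lambda : nat -> R)
  (hlambda : eigenvalues_desc (grad_cov X rho gradf) lambda)
  (hlambda1 : 0 < lambda 1%N)
  (d : measure_display) (W : measurableType d) (P : probability W R)
  (N : nat) (hN : (1 <= N)%N)
  (x : 'I_N -> {RV P >-> 'cV[R]_m})
  (hindep : independent_RVs x)
  (hlaw : forall j, has_density (lebesgue_cV m) (x j) rho)
  (lambdahat : W -> nat -> R)
  (hlambdahat : forall w,
    eigenvalues_desc (sample_grad_cov X gradf (fun j => x j w)) (lambdahat w))
  (k : nat) (hk : (1 <= k <= m)%N)
  (eps : R) (heps : 0 < eps <= 1) :
  (P [set w | ((1 + eps) * lambda k <= lambdahat w k)%R] <=
     ((m - k + 1)%N%:R *
      expR (- (N%:R * lambda k * eps ^+ 2) / (4 * L ^+ 2)))%:E)%E /\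
  (P [set w | (lambdahat w k <= (1 - eps) * lambda k)%R] <=
     (k%:R *
      expR (- (N%:R * lambda k ^+ 2 * eps ^+ 2) /
              (4 * lambda 1%N * L ^+ 2)))%:E)%E.
Proof.
have /andP[eps0 eps1] := heps; have /andP[k1 km] := hk.
have [mrho rho_ge0 _] := hrho.
have dotE' u v : @dotv R m u v = dot u v by rewrite dotE.
(* [X] is exactly the set where the measurable function [rho] is positive. *)
have mX : measurable X.
  rewrite (_ : X = rho @^-1` `]0, +oo[%classic).
    by rewrite -[X in measurable X]setTI; exact: mrho.
  apply/seteqP; split => t /=; rewrite in_itv /= andbT; first exact: hpos.
  by move=> rt; apply: contrapT => /hzero rt0; rewrite rt0 ltxx in rt.
(* Extension by 0 agrees with [sample_grad_cov] and makes the norm bound hold everywhere rather than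
   almost surely. *)
pose g t := if t \in X then gradf t else 0.
have gE t : g t *m (g t)^T = if t \in X then outer (gradf t) else 0.
  by rewrite /g; case: ifP => // _; rewrite mul0mx.
have ga t : dot (g t) (g t) <= L ^+ 2.
  rewrite /g; case: ifPn => [|_]; last by rewrite dot0l sqr_ge0.
  rewrite inE => /hL gL; rewrite -(sqr_sqrtr (dot_ge0 _)).
  by rewrite lerXn2r ?nnegrE ?sqrtr_ge0 // -?dotE' ?(le_trans (sqrtr_ge0 _) gL).
have mG : measurable_mx (fun t => g t *m (g t)^T).
  move=> i j; rewrite (_ : (fun t => _) = (fun t => outer (gradf t) i j) \_ X).
    by apply/(measurable_restrictT _ mX).
  by apply/funext => t; rewrite patchE gE; case: ifP => // _; rewrite mxE.
pose C := grad_cov X rho gradf.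
have EG j i k' : (\int[distribution P (x j)]_t ((g t *m (g t)^T) i k')%:E =
    (C i k')%:E)%E.
  have intG := integrable_outer (distribution P (x j)) mG ga i k'.
  have E1 := density_integral mrho (hlaw j) intG.
  rewrite -[LHS]fineK ?integrable_fin_num //; congr (_%:E).
  rewrite E1 mxE /Rintegral; congr fine.
  rewrite [RHS]integral_mkcond; apply: eq_integral => t _.
  by rewrite patchE gE; case: ifP => _; rewrite ?mxE ?mul0e.
have symC : C^T = C.
  apply/matrixP => i j; rewrite !mxE; apply: eq_Rintegral => t _.
  by congr (_ * _); rewrite !mxE; apply: eq_bigr => h _; rewrite !mxE mulrC.
have eigChat w : eigenvalues_desc
    (N%:R^-1 *: \sum_j g (x j w) *m (g (x j w))^T) (lambdahat w).
  have := hlambdahat w; congr (eigenvalues_desc _ _); rewrite /sample_grad_cov.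
  by congr (_ *: _); apply: eq_bigr => j _; rewrite gE.
have mlh := measurable_sample_eigenvalue mG eigChat hk.
have mE1 : measurable [set w | (1 + eps) * lambda k <= lambdahat w k].
  by rewrite -[X in measurable X]setTI; apply: measurable_fun_le.
have mE2 : measurable [set w | lambdahat w k <= (1 - eps) * lambda k].
  by rewrite -[X in measurable X]setTI; apply: measurable_fun_le.
(* Division by 0 gives 0: both exponentials equal 1, the prefactors are at least 1, and a
   probability is at most 1. *)
have [L0|L0] := eqVneq L 0.
  rewrite L0 expr0n /= !mulr0 invr0 !mulr0 expR0 !mulr1.
  split; apply: (le_trans (probability_le1 _ _)) => //; rewrite lee_fin ler1n //.
  by rewrite addn1.
have a0 : 0 < L ^+ 2 by rewrite exprn_even_gt0.
rewrite -[X in (X <= _)%E /\ _]fineK ?fin_num_measure //.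
rewrite -[X in _ /\ (X <= _)%E]fineK ?fin_num_measure //.
rewrite !lee_fin; split.
  apply: le_trans (sample_eigenvalue_upper_tail hindep hN mG ga EG symC hlambda
    eigChat a0 hk heps) _.
  rewrite ler_wpM2l // ler_expR le_eqVlt; apply/orP; left; apply/eqP.
  by field.
apply: le_trans (sample_eigenvalue_lower_tail hindep hN mG ga EG symC hlambda
  eigChat a0 hk heps) _.
rewrite ler_wpM2l // ler_expR.
(* The exponent obtained has lambda_k where the claim has lambda_k^2 / lambda_1, which is no
   larger. *)
have lk1 : lambda k <= lambda 1%N by apply: (proj2 hlambda).
have lk0 := eigenvalue_mean_ge0 hN mG ga EG symC hlambda hk.
have -> : - (N%:R * lambda k * (eps / 2) ^+ 2 / L ^+ 2) =
    - (N%:R * eps ^+ 2 / (4 * L ^+ 2) * lambda k) by field.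
have -> : - (N%:R * lambda k ^+ 2 * eps ^+ 2) / (4 * lambda 1%N * L ^+ 2) =
    - (N%:R * eps ^+ 2 / (4 * L ^+ 2) * (lambda k ^+ 2 / lambda 1%N)).
  by field; rewrite L0 gt_eqF.
rewrite lerN2 ler_wpM2l //.
  by rewrite divr_ge0 // mulr_ge0 // ?sqr_ge0 // ltW.
by rewrite ler_pdivrMr // expr2 ler_wpM2l.
Qed.
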